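(* Let $A$ and $V$ be bounded self-adjoint operators on a separable Hilbert space $\mathfrak{H}$. Suppose that $\mathrm{spec}(A)=\sigma\cup\Sigma$ with $\mathrm{dist}(\sigma,\Sigma)=d>0$. Let $P=\mathsf{E}_A(\sigma)$ and $Q=\mathsf{E}_{A+V}(U_{d/2}(\sigma))$. Suppose that $V$ is a compact operator satisfying $\|V\|<\frac d2$. Then the pair $(P,Q)$ is Fredholm with zero index. In particular, the subspaces $\mathrm{Ker}(PQ^\perp-I)$ and $\mathrm{Ker}(P^\perp Q-I)$ are finite-dimensional and $$\dim\mathrm{Ker}(PQ^\perp-I)=\dim\mathrm{Ker}(P^\perp Q-I).$$
   Context: $\mathrm{spec}(A)$ denotes the spectrum of $A$. For a Borel set $\Delta\subset\mathbb{R}$ and a bounded self-adjoint operator $B$, $\mathsf{E}_B(\Delta)$ denotes the spectral projection of $B$ corresponding to $\Delta$. For nonempty $S,T\subset\mathbb{R}$, $\mathrm{dist}(S,T)=\inf\{|s-t| : s\in S, t\in T\}$. $U_\varepsilon(\sigma)$, $\varepsilon>0$, is the open $\varepsilon$-neighborhood of $\sigma$ in $\mathbb{R}$. For an orthogonal projection $P$, $P^\perp=I-P$. A pair $(P,Q)$ of orthogonal projections is called Fredholm if the operator $QP$, viewed as a map from $\mathrm{Ran}\,P$ to $\mathrm{Ran}\,Q$, is a Fredholm operator; the index of this operator is called the index of the pair $(P,Q)$. *)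

(* Defs.v *)
From HB Require Import structures.
From mathcomp Require Import all_boot all_order all_algebra.
From mathcomp Require Import complex.
From mathcomp Require Import all_classical all_reals all_analysis.

Set Implicit Arguments.
Unset Strict Implicit.
Unset Printing Implicit Defensive.

Import Order.TTheory GRing.Theory Num.Theory.
Import numFieldNormedType.Exports.

Local Open Scope classical_set_scope.
Local Open Scope ring_scope.

Section sets_of_reals.
Variable R : realType.
Implicit Types S T : set R.

Definition set_dist S T : R := inf [set `|s - t| | s in S & t in T].

Definition set_nbhd (e : R) S : set R := [set t | exists2 s, S s & `|t - s| < e].

End sets_of_reals.

Section operators.
Variables (R : realType) (H : completeNormedModType R[i]).
Implicit Types (T : H -> H) (M N : set H).

Definition separable : Prop := exists2 D : set H, countable D & dense D.

(* A complete normed space over R[i] becomes a Hilbert space once its norm is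
   induced by an inner product; as in [{dot _ for _}], the form is linear in its
   first argument and conjugate-linear in the second one. *)
Definition induces_norm (ip : {dot H for Num.conj}) : Prop :=
  forall x, `|x| ^+ 2 = ip x x.

(* Norms in H take their values in R[i]; they are nonnegative reals there. *)
Definition op_norm T : R := sup [set complex.Re `|T x| | x in [set x | `|x| <= 1]].

Definition compact_operator T : Prop := precompact (T @` [set x | `|x| <= 1]).

Definition op_ker T : set H := [set x | T x = 0].

Definition op_perp T : H -> H := fun x => x - T x.

Definition spectrum T : set R[i] :=
  [set l | ~ exists2 S : {linear H -> H}, continuous S &
     cancel (fun x => T x - l *: x) S /\ cancel S (fun x => T x - l *: x)].

(* For subspaces M `<=` N: the classes of the family b form a basis of N / M. *)
Definition quotient_basis M N n (b : 'I_n -> H) : Prop :=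
  (forall i, N (b i)) /\
  (forall x, N x -> exists! c : 'rV[R[i]]_n, M (x - \sum_i c 0 i *: b i)).

Definition has_codim M N (n : nat) : Prop :=
  exists b : 'I_n -> H, quotient_basis M N b.

Definition finite_codim M N : Prop := exists n, has_codim M N n.

(* dim (N / M), with value 0 when this dimension is infinite. *)
Definition codim M N : nat := xget 0%N [set n | has_codim M N n].

Definition finite_dimensional N : Prop := finite_codim [set 0] N.

Definition dimension N : nat := codim [set 0] N.

Definition ker_on T M : set H := M `&` op_ker T.

(* T, restricted to the subspace M, as an operator from M to the closed
   subspace N; closedness of its range in N and in H are the same. *)
Definition fredholm T M N : Prop :=
  [/\ T @` M `<=` N, finite_dimensional (ker_on T M), closed (T @` M)
    & finite_codim (T @` M) N].

Definition fredholm_index T M N : int :=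
  (dimension (ker_on T M))%:Z - (codim (T @` M) N)%:Z.

Definition fredholm_pair (P Q : H -> H) : Prop :=
  fredholm (Q \o P) (range P) (range Q).

Definition pair_index (P Q : H -> H) : int :=
  fredholm_index (Q \o P) (range P) (range Q).

Variable ip : {dot H for Num.conj}.

Definition self_adjoint T : Prop := forall x y, ip (T x) y = ip x (T y).

Definition orthogonal_projection (P : {linear H -> H}) : Prop :=
  [/\ continuous P, self_adjoint P & forall x, P (P x) = P x].

(* Only the values on Borel sets are constrained. *)
Definition bounded_pvm (E : set (measurableTypeR R) -> {linear H -> H}) : Prop :=
  [/\ forall D, measurable D -> orthogonal_projection (E D),
      forall x, E set0 x = 0,
      exists a : R, forall x, E `]-a, a[%classic x = x
    & forall F : (set (measurableTypeR R))^nat,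
        (forall n, measurable (F n)) -> trivIset setT F ->
        forall x, (fun n => \sum_(0 <= k < n) E (F k) x) @ \oo
                    --> E (\bigcup_n F n) x].

(* The measure D |-> <E(D) x, x>, whose values are real. *)
Definition scalar_measure (E : set (measurableTypeR R) -> {linear H -> H})
    (x : H) : set (measurableTypeR R) -> \bar R :=
  fun D => (complex.Re (ip (E D x) x))%:E.

(* B = \int t dE(t), in the sense of quadratic forms; E is the spectral measure
   of the bounded self-adjoint operator B, and E D is the spectral projection of
   B corresponding to the Borel set D.  The integrals are finite since E is
   supported in a bounded interval. *)
Definition spectral_measure T (E : set (measurableTypeR R) -> {linear H -> H}) :
    Prop :=
  bounded_pvm E /\
  forall x, ip (T x) x =
    (fine (\int[scalar_measure E x]_(t in setT) t%:E)%E)%:C%C.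

End operators.

(* Main.v *)
Require Import Defs.
From HB Require Import structures.
From mathcomp Require Import all_boot all_order all_algebra.
From mathcomp Require Import complex ring lra.
From mathcomp Require Import all_classical all_reals all_analysis.
Import Order.TTheory GRing.Theory Num.Theory.
Import numFieldNormedType.Exports.
Local Open Scope classical_set_scope.
Local Open Scope ring_scope.

(** For projections with [P - Q] compact, [Q P : Ran P -> Ran Q] is Fredholm: on
  [Ran Q] the operator [Q P Q] differs from the identity by a compact operator.
  Its kernel is [defect P Q], its range is the orthogonal of [defect Q P] in
  [Ran Q], and its index is the difference of the two dimensions
  ([fredholm_pairP]). So the theorem asks for the compactness of [P - Q] and for
  defect spaces of equal dimension.

  Half-lines are easy. Let [c] be the midpoint of a spectral gap of [A] of length
  at least [d], and compare the spectral projections of [A] and [A + V] for the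
  half-line below [c]. On a unit vector of [defect P Q] the form of [A] is at most
  [c - d / 2] and that of [A + V] is at least [c], although they differ by less
  than [d / 2]; the other defect space vanishes for the same reason. The
  difference of the projections is compact because [X = (1 - Q) P] solves the
  Sylvester equation [(A + V - t) X = X (A - t) + (1 - Q) V P], in which a
  suitable [t] makes [A - t] on [Ran P] smaller than [A + V - t] on the other
  side. So [X] is compact up to a strict contraction of itself
  ([compact_separated]).

  The general case reduces to half-lines by index additivity. If the families
  [P_j] and [Q_j] are resolutions of the identity with compact differences,
  then [\sum_j Q_j P_j] is a compact perturbation of the identity, so its
  index, the sum of the indices of the pairs, is zero ([defect_dim_eq]). At a
  cut [c] there are three blocks: the part of [sigma] below [c], the part of
  [Sigma] below [c], and everything above [c]; the index of the third one is
  zero. Hence index zero for one of the two clusters below [c] gives it for the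
  other ([balanced_complement]). Going from one cut to the next, only one
  cluster acquires points, and an induction over the cuts settles both
  ([balanced_below]).

  Two facts put this in motion. The spectral measure of [A] lives on the
  spectrum, and that of [A + V] on its neighbourhood of radius [d / 2]
  ([pvm_spectrum], [pvm_nbhd_spectrum]). The Fredholm alternative
  ([fredholm_alternative]) follows from approximating a compact operator by a
  finite-rank one, so that a Neumann series and a square linear system
  suffice. *)

Set Implicit Arguments.
Unset Strict Implicit.
Unset Printing Implicit Defensive.

(** * The norm and the inner product, read in the real field *)

Section hilbert.
Variables (R : realType) (H : completeNormedModType R[i]).
Implicit Types x y z : H.

Definition nr x : R := complex.Re `|x|.

Lemma normE x : `|x| = (nr x)%:C%C.
Proof. by rewrite /nr RRe_real// ger0_real. Qed.

Lemma nr_ge0 x : 0 <= nr x.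
Proof. by rewrite -ler0c -normE. Qed.

Lemma nr0 : nr 0 = 0.
Proof. by rewrite /nr normr0. Qed.

Lemma nr_eq0 x : nr x = 0 -> x = 0.
Proof. by move=> h; apply/normr0_eq0; rewrite normE h. Qed.

Lemma nrN x : nr (- x) = nr x.
Proof. by rewrite /nr normrN. Qed.

Lemma nrD x y : nr (x + y) <= nr x + nr y.
Proof. by rewrite -lecR rmorphD /= -!normE ler_normD. Qed.

Lemma nrB x y : nr (x - y) <= nr x + nr y.
Proof. by rewrite (le_trans (nrD _ _))// nrN. Qed.

Lemma nr_distC x y : nr (x - y) = nr (y - x).
Proof. by rewrite -nrN opprB. Qed.

Lemma nrZ (a : R[i]) x : nr (a *: x) = complex.Re `|a| * nr x.
Proof.
have e : `|a| = (complex.Re `|a|)%:C%C by rewrite RRe_real// ger0_real.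
by apply: complexI; rewrite -normE normrZ e normE -rmorphM.
Qed.

Lemma nrZr (a : R) x : nr (a%:C%C *: x) = `|a| * nr x.
Proof. by rewrite nrZ normc_def /= expr0n/= addr0 sqrtr_sqr. Qed.

Variable (ip : {dot H for Num.conj}).

(** A real symmetric form: self-adjoint operators are estimated through their
  real numerical range, where only the real part matters. *)
Definition rip x y : R := complex.Re (ip x y).

Lemma ripDl x y z : rip (x + y) z = rip x z + rip y z.
Proof. by rewrite /rip linearDl raddfD. Qed.
Lemma ripDr x y z : rip z (x + y) = rip z x + rip z y.
Proof. by rewrite /rip linearDr raddfD. Qed.
Lemma ripNl x z : rip (- x) z = - rip x z.
Proof. by rewrite /rip linearNl raddfN. Qed.
Lemma ripNr x z : rip z (- x) = - rip z x.
Proof. by rewrite /rip linearNr raddfN. Qed.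
Lemma ripBl x y z : rip (x - y) z = rip x z - rip y z.
Proof. by rewrite ripDl ripNl. Qed.
Lemma ripBr x y z : rip z (x - y) = rip z x - rip z y.
Proof. by rewrite ripDr ripNr. Qed.
Lemma ip_conj x y : ip x y = ((ip y x)^*)%C.
Proof. by rewrite hermC /= expr0 mul1r. Qed.
Lemma ripC x y : rip x y = rip y x.
Proof. by rewrite /rip ip_conj; case: (ip y x). Qed.
Lemma ripZl (a : R) x y : rip (a%:C%C *: x) y = a * rip x y.
Proof. by rewrite /rip linearZl_LR /=; case: (ip x y) => u v /=; ring. Qed.
Lemma ripZr (a : R) x y : rip x (a%:C%C *: y) = a * rip x y.
Proof. by rewrite ripC ripZl ripC. Qed.
Lemma rip0l x : rip 0 x = 0. Proof. by rewrite /rip linear0l. Qed.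
Lemma rip0r x : rip x 0 = 0. Proof. by rewrite ripC rip0l. Qed.

Hypothesis hip : induces_norm ip.

Lemma ripxx x : rip x x = nr x ^+ 2.
Proof. by rewrite /rip -hip normE -rmorphXn. Qed.

Lemma ipxx x : ip x x = ((nr x ^+ 2)%:C)%C.
Proof. by rewrite -hip normE -rmorphXn. Qed.

Lemma nrD2 x y : nr (x + y) ^+ 2 = nr x ^+ 2 + 2 * rip x y + nr y ^+ 2.
Proof. rewrite -!ripxx !(ripDl, ripDr) (ripC y x); ring. Qed.

Lemma nrB2 x y : nr (x - y) ^+ 2 = nr x ^+ 2 - 2 * rip x y + nr y ^+ 2.
Proof. by rewrite nrD2 ripNr nrN mulrN. Qed.

Lemma cauchy_schwarz x y : rip x y <= nr x * nr y.
Proof.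
have [/nr_eq0 ->|x0] := eqVneq (nr x) 0; first by rewrite rip0l nr0 mul0r.
have [/nr_eq0 ->|y0] := eqVneq (nr y) 0; first by rewrite rip0r nr0 mulr0.
have := sqr_ge0 (nr ((nr y)%:C%C *: x - (nr x)%:C%C *: y)).
rewrite nrB2 ripZl ripZr !nrZr !ger0_norm ?nr_ge0// => h.
have p : 0 < nr x * nr y by rewrite mulr_gt0// lt_def nr_ge0 andbT.
rewrite -(ler_pM2l p); move: h; set a := nr x; set b := nr y; nra.
Qed.

Lemma ripN_le x y : - (nr x * nr y) <= rip x y.
Proof. by rewrite -(nrN y) lerNl -ripNr cauchy_schwarz. Qed.

Lemma ler_sqrn (a b : R) : 0 <= b -> a ^+ 2 <= b ^+ 2 -> a <= b.
Proof. by move=> b0 h; case: (leP a 0) => a0; nra. Qed.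

End hilbert.

(** * Compact maps and Neumann series *)

Section compact_maps.
Variables (R : realType) (H : completeNormedModType R[i]).
Implicit Types (x y z : H) (S T B K : H -> H).

(** Total boundedness of the image of the unit ball, with a finite partition of
  the ball in place of a finite net: images of equally coloured points are
  close. Colourings combine by pairing and pull back along contractions, which
  replaces the extraction of subsequences. *)
Definition compact_map T : Prop := forall e : R, 0 < e ->
  exists (F : finType) (k : H -> F), forall x y,
    nr x <= 1 -> nr y <= 1 -> k x = k y -> nr (T x - T y) <= e.

Lemma eq_compact_map S T : S =1 T -> compact_map S -> compact_map T.
Proof.
move=> ST cS e e0; have [F [k hk]] := cS e e0; exists F, k => x y hx hy kxy.
by rewrite -!ST hk.
Qed.

Lemma compact_mapD S T : compact_map S -> compact_map T ->
  compact_map (fun x => S x + T x).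
Proof.
move=> cS cT e e0; have e2 : 0 < e / 2 by rewrite divr_gt0.
have [F [k hk]] := cS _ e2; have [G [l hl]] := cT _ e2.
exists (F * G)%type, (fun x => (k x, l x)) => x y hx hy [kxy lxy].
rewrite opprD addrACA (le_trans (nrD _ _))//.
by rewrite [leRHS](splitr e) lerD ?hk ?hl.
Qed.

Lemma compact_mapN T : compact_map T -> compact_map (fun x => - T x).
Proof.
move=> cT e e0; have [F [k hk]] := cT e e0; exists F, k => x y hx hy kxy.
by rewrite -opprD nrN hk.
Qed.

Lemma compact_mapB S T : compact_map S -> compact_map T ->
  compact_map (fun x => S x - T x).
Proof. by move=> cS /compact_mapN; exact: compact_mapD. Qed.

Lemma compact_map0 : compact_map (fun=> 0).
Proof.
by move=> e e0; exists unit, (fun=> tt) => x y _ _ _; rewrite subr0 nr0 ltW.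
Qed.

Lemma compact_map_sum n (T : 'I_n -> H -> H) :
  (forall i, compact_map (T i)) -> compact_map (fun x => \sum_i T i x).
Proof.
elim: n T => [|n IH] T cT.
  by apply: eq_compact_map compact_map0 => x; rewrite big_ord0.
have := compact_mapD (cT ord0) (IH _ (fun i => cT (lift ord0 i))).
by apply: eq_compact_map => x; rewrite big_ord_recl.
Qed.

Lemma compact_map_compl (B : {linear H -> H}) T (b : R) :
  (forall x, nr (B x) <= b * nr x) -> compact_map T -> compact_map (B \o T).
Proof.
move=> hb cT e e0; pose c := `|b| + 1.
have c0 : 0 < c by rewrite ltr_wpDl.
have [F [k hk]] := cT (e / c) (divr_gt0 e0 c0).
exists F, k => x y hx hy kxy /=; rewrite -linearB (le_trans (hb _))//.
rewrite (@le_trans _ _ (c * nr (T x - T y)))//.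
  by rewrite ler_wpM2r ?nr_ge0// (le_trans (ler_norm _))// lerDl.
by rewrite mulrC -ler_pdivlMr// hk.
Qed.

Lemma compact_map_compr T B : (forall x, nr (B x) <= nr x) ->
  compact_map T -> compact_map (T \o B).
Proof.
move=> hb cT e e0; have [F [k hk]] := cT e e0; exists F, (k \o B) => x y hx hy.
by apply: hk; rewrite (le_trans (hb _)).
Qed.

Lemma linear_bounded_nr (T : {linear H -> H}) (c : R) : 0 <= c ->
  (forall x, nr x <= 1 -> nr (T x) <= c) -> forall x, nr (T x) <= c * nr x.
Proof.
move=> c0 h x; have [/nr_eq0 ->|x0] := eqVneq (nr x) 0.
  by rewrite linear0 nr0 mulr0.
have p : 0 < nr x by rewrite lt_def x0 nr_ge0.
have := h ((nr x)^-1%:C%C *: x).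
rewrite linearZ /= !nrZr gtr0_norm ?invr_gt0// mulVf// => /(_ (lexx _)).
by rewrite mulrC ler_pdivrMr.
Qed.

(** The iteration [x_(n+1) = y - G x_n] converges geometrically. *)
Lemma neumann_surj (G : {linear H -> H}) (q : R) : 0 <= q -> q < 1 ->
  (forall x, nr (G x) <= q * nr x) -> forall y, exists x, x + G x = y.
Proof.
move=> q0 q1 hG y; pose u := fix u n := if n is m.+1 then y - G (u m) else 0.
(* the solution of [nr y + q * c = c], which bounds all the iterates *)
pose c := nr y / (1 - q).
have q1' : 0 < 1 - q by rewrite subr_gt0.
have c0 : 0 <= c by rewrite divr_ge0 ?nr_ge0// ltW.
have cE : nr y + q * c = c by rewrite /c; field; rewrite gt_eqF.
have uc n : nr (u n) <= c.
  elim: n => [|n IH] /=; first by rewrite nr0.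
  by rewrite (le_trans (nrB _ _))// -[leRHS]cE lerD2l (le_trans (hG _))// ler_wpM2l.
have ucauchy N k : nr (u (N + k)%N - u N) <= q ^+ N * c.
  elim: N => [|N IH]; first by rewrite /= subr0 expr0 mul1r uc.
  rewrite addSn /= opprD opprK addrACA subrr add0r addrC -linearB.
  by rewrite (le_trans (hG _))// exprS -mulrA ler_wpM2l// nr_distC.
have small (e : R) : 0 < e -> exists N, q ^+ N * c < e.
  move=> e0; have : (fun n => q ^+ n * c) @ \oo --> (0 : R).
    rewrite -[X in _ --> X](mul0r c); apply: cvgMl.
    by apply: cvg_expr; rewrite ger0_norm.
  move=> /cvgrPdist_lt /(_ _ e0) [N _ hN]; exists N.
  have := hN N (leqnn _); rewrite sub0r normrN; apply: le_lt_trans.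
  exact: ler_norm.
have cu : cvg (u @ \oo).
  apply: cauchy_cvg; apply/cauchy_exP => /= e e0.
  have e0' : 0 < complex.Re e by move: e0; rewrite ltcE => /andP[_].
  have [N hN] := small _ e0'; exists (u N), N => // n /= Nn.
  rewrite -ball_normE /= -(subnKC Nn) normE nr_distC.
  move: e0 (le_lt_trans (ucauchy N (n - N)%N) hN); rewrite !ltcE /= => /andP[-> _] ->.
  by [].
exists (lim (u @ \oo)); set x := lim _.
apply/eqP; rewrite -subr_eq0; apply/eqP/nr_eq0/le_anti; rewrite nr_ge0 andbT.
apply/ler_addgt0Pl => e e0; rewrite addr0.
have e20 : 0 < ((e / 2)%:C)%C by rewrite ltcR divr_gt0.
have /cvgrPdist_lt /(_ _ e20) [N _ hN] := cu.
have h1 := hN N (leqnn _); have h2 := hN N.+1 (leqnSn _).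
rewrite -/x normE ltcR in h1; rewrite -/x normE ltcR in h2.
have -> : x + G x - y = (x - u N.+1) + G (x - u N).
  rewrite -[u N.+1]/(y - G (u N)) [G (x - _)]linearB /= opprB addrACA.
  by rewrite [G (u N) - y]addrC addrK.
rewrite (le_trans (nrD _ _))// [leRHS](splitr e) lerD ?ltW//.
rewrite (le_lt_trans (hG _))// (le_lt_trans _ h1)//.
by rewrite ler_piMl ?nr_ge0 ?ltW.
Qed.

End compact_maps.

(** * Orthonormal families *)

Section orthonormal_families.
Variables (R : realType) (H : completeNormedModType R[i]).
Variable (ip : {dot H for Num.conj}).
Implicit Types (x y z : H) (N : set H).

Definition orthonormal_family n (u : 'I_n -> H) : Prop :=
  forall i j, ip (u i) (u j) = (i == j)%:R.

Definition ortho_part n (u : 'I_n -> H) x : H := \sum_i ip x (u i) *: u i.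

Definition subspace N : Prop :=
  N 0 /\ forall (a : R[i]) x y, N x -> N y -> N (a *: x + y).

Lemma subspaceD N x y : subspace N -> N x -> N y -> N (x + y).
Proof. by move=> [_ h] Nx Ny; have := h 1 x y Nx Ny; rewrite scale1r. Qed.

Lemma subspaceZ N a x : subspace N -> N x -> N (a *: x).
Proof. by move=> [h0 h] Nx; have := h a x 0 Nx h0; rewrite addr0. Qed.

Lemma subspaceN N x : subspace N -> N x -> N (- x).
Proof. by move=> h Nx; rewrite -scaleN1r; apply: subspaceZ. Qed.

Lemma subspaceB N x y : subspace N -> N x -> N y -> N (x - y).
Proof. by move=> h Nx /(subspaceN h); apply: subspaceD. Qed.

Lemma subspace_sum N n (F : 'I_n -> H) : subspace N ->
  (forall i, N (F i)) -> N (\sum_i F i).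
Proof.
move=> h hF; elim/big_ind : _ => //; first by case: h.
by move=> x y; apply: subspaceD.
Qed.

Lemma ortho_part_is_linear n (u : 'I_n -> H) : linear (ortho_part u).
Proof.
move=> a x y; rewrite /ortho_part scaler_sumr -big_split; apply: eq_bigr => i _.
by rewrite linearPl /= scalerDl scalerA.
Qed.

HB.instance Definition _ n (u : 'I_n -> H) :=
  GRing.isLinear.Build _ _ _ _ (ortho_part u) (ortho_part_is_linear u).

Lemma ip_suml n (F : 'I_n -> H) y : ip (\sum_i F i) y = \sum_i ip (F i) y.
Proof.
by elim/big_rec2 : _ => [|i a b _ <-]; rewrite ?linear0l// linearDl.
Qed.

Lemma ip_sym0 x y : ip x y = 0 -> ip y x = 0.
Proof. by move=> h; rewrite ip_conj h conjc0. Qed.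

Lemma ip_comb n (u : 'I_n -> H) (c : 'I_n -> R[i]) j : orthonormal_family u ->
  ip (\sum_i c i *: u i) (u j) = c j.
Proof.
move=> ou; rewrite ip_suml (bigD1 j)//= big1 => [|i ij].
  by rewrite addr0 linearZl_LR /= ou eqxx mulr1.
by rewrite linearZl_LR /= ou (negbTE ij) mulr0.
Qed.

Lemma ip_ortho_part n (u : 'I_n -> H) x j : orthonormal_family u ->
  ip (ortho_part u x) (u j) = ip x (u j).
Proof. by move=> ou; rewrite ip_comb. Qed.

Lemma ortho_part_comb n (u : 'I_n -> H) (c : 'I_n -> R[i]) : orthonormal_family u ->
  ortho_part u (\sum_i c i *: u i) = \sum_i c i *: u i.
Proof. by move=> ou; apply: eq_bigr => i _; rewrite ip_comb. Qed.

Lemma ortho_part_id n (u : 'I_n -> H) x : orthonormal_family u ->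
  ortho_part u (ortho_part u x) = ortho_part u x.
Proof. by move=> ou; rewrite ortho_part_comb. Qed.

Lemma ip_ortho_rest n (u : 'I_n -> H) x j : orthonormal_family u ->
  ip (x - ortho_part u x) (u j) = 0.
Proof. by move=> ou; rewrite linearBl /= ip_ortho_part// subrr. Qed.

Lemma ip_ortho_part0 n (u : 'I_n -> H) x y :
  (forall i, ip x (u i) = 0) -> ip x (ortho_part u y) = 0.
Proof.
move=> h; apply: ip_sym0; rewrite ip_suml big1// => i _.
by rewrite linearZl_LR /= (ip_sym0 (h i)) mulr0.
Qed.

Lemma ortho_part_mem n (u : 'I_n -> H) N x : subspace N ->
  (forall i, N (u i)) -> N (ortho_part u x).
Proof. by move=> sN Nu; apply: subspace_sum => // i; apply: subspaceZ. Qed.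

Hypothesis hip : induces_norm ip.

Lemma nr_ortho_rest n (u : 'I_n -> H) x : orthonormal_family u ->
  nr (x - ortho_part u x) <= nr x.
Proof.
move=> ou; apply: ler_sqrn; first exact: nr_ge0.
rewrite -[in leRHS](subrK (ortho_part u x) x) [leRHS](nrD2 hip).
rewrite /rip ip_ortho_part0 => [|i]; last exact: ip_ortho_rest.
by rewrite mulr0 addr0 lerDl sqr_ge0.
Qed.

Definition extend n (u : 'I_n -> H) v : 'I_n.+1 -> H :=
  fun i => if unlift ord0 i is Some j then u j else v.

Lemma extend0 n (u : 'I_n -> H) v : extend u v ord0 = v.
Proof. by rewrite /extend unlift_none. Qed.

Lemma extend_lift n (u : 'I_n -> H) v i : extend u v (lift ord0 i) = u i.
Proof. by rewrite /extend liftK. Qed.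

Lemma extend_orthonormal n (u : 'I_n -> H) v : orthonormal_family u ->
  (forall i, ip v (u i) = 0) -> nr v = 1 -> orthonormal_family (extend u v).
Proof.
move=> ou vu v1 i j; case: (unliftP ord0 i) => [i'|] ->;
  case: (unliftP ord0 j) => [j'|] ->; rewrite ?extend0 ?extend_lift.
- by rewrite ou (inj_eq lift_inj).
- by rewrite (ip_sym0 (vu _)).
- by rewrite vu.
- by rewrite (ipxx hip) v1 expr1n eqxx.
Qed.

(** The Gram-Schmidt step. The new vector lies in every subspace that contains
  [u] and [x], which keeps an extended family inside the space it is to span. *)
Lemma extend_span n (u : 'I_n -> H) x : orthonormal_family u ->
  ortho_part u x != x -> exists v, [/\ orthonormal_family (extend u v),
    forall N, subspace N -> (forall i, N (u i)) -> N x -> N v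
    & ortho_part (extend u v) x = x].
Proof.
move=> ou xu; pose w := x - ortho_part u x.
have w0 : nr w != 0.
  by apply: contra_neq xu => /nr_eq0 /eqP; rewrite subr_eq0 => /eqP.
pose c := ((nr w)^-1%:C)%C; exists (c *: w).
have wu i : ip w (u i) = 0 by exact: ip_ortho_rest.
have vu i : ip (c *: w) (u i) = 0 by rewrite linearZl_LR /= wu mulr0.
have ov : orthonormal_family (extend u (c *: w)).
  apply: extend_orthonormal => //.
  by rewrite nrZr ger0_norm ?invr_ge0 ?nr_ge0// mulVf.
split => // [N sN Nu Nx|].
  by apply: subspaceZ => //; apply: subspaceB => //; exact: ortho_part_mem.
have xE : x = \sum_i (extend (fun i => ip x (u i) *: u i) w) i.
  rewrite big_ord_recl extend0; under eq_bigr do rewrite extend_lift.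
  by rewrite -/(ortho_part _ _) subrK.
pose d (i : 'I_n.+1) := if unlift ord0 i is Some j then ip x (u j) else (nr w)%:C%C.
rewrite [X in ortho_part _ X = X](_ : x = \sum_i d i *: extend u (c *: w) i).
  exact: ortho_part_comb.
rewrite {1}xE; apply: eq_bigr => i _; rewrite /extend /d.
case: (unlift ord0 i) => //; rewrite scalerA -rmorphM /= divff// .
by rewrite scale1r.
Qed.

Lemma gram_schmidt (s : seq H) : exists n (u : 'I_n -> H),
  orthonormal_family u /\ forall y, y \in s -> ortho_part u y = y.
Proof.
elim: s => [|x s [n [u [ou hu]]]].
  by exists 0%N, (fun=> 0); split => //; case.
have [xu|xu] := eqVneq (ortho_part u x) x.
  by exists n, u; split=> // y; rewrite inE => /predU1P[->|/hu].
have [v [ov _ vx]] := extend_span ou xu; exists n.+1, (extend u v); split => // y.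
rewrite inE => /predU1P[->//|/hu hy].
have -> : y = \sum_i (if unlift ord0 i is Some j then ip y (u j) else 0) *:
    extend u v i.
  rewrite big_ord_recl unlift_none scale0r add0r -[LHS]hy.
  by apply: eq_bigr => i _; rewrite liftK extend_lift.
exact: ortho_part_comb.
Qed.

(** Projecting onto the span of the images of one representative per colour
  moves the image of the unit ball by at most [e]. *)
Lemma compact_map_approx (K : {linear H -> H}) (e : R) : compact_map K -> 0 < e ->
  exists n (u : 'I_n -> H), orthonormal_family u /\
    forall x, nr (K x - ortho_part u (K x)) <= e * nr x.
Proof.
move=> cK e0; have [F [k hk]] := cK e e0.
pose rep (f : F) := xget 0 [set x | nr x <= 1 /\ k x = f].
have [n [u [ou hu]]] := gram_schmidt [seq K (rep f) | f <- enum F].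
exists n, u; split => // x.
suff h y : nr y <= 1 -> nr (K y - ortho_part u (K y)) <= e.
  have l : linear (fun x => K x - ortho_part u (K x)).
    by move=> a y z; rewrite !linearP /= scalerDr addrACA.
  pose D : {linear H -> H} := HB.pack (fun x => K x - ortho_part u (K x))
    (GRing.isLinear.Build _ _ _ _ _ l).
  by apply: (@linear_bounded_nr _ _ D e (ltW e0)) => y; exact: h.
move=> y1; set z := rep (k y).
have [z1 kz] : nr z <= 1 /\ k z = k y.
  by rewrite /z /rep; case: xgetP => [_ -> //|/(_ y)[]].
have zE : ortho_part u (K z) = K z.
  by apply: hu; apply/mapP; exists (k y) => //; rewrite mem_enum.
have -> : K y - ortho_part u (K y) = (K y - K z) - ortho_part u (K y - K z).
  by rewrite linearB /= zE opprB addrA subrK.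
by rewrite (le_trans (nr_ortho_rest _ ou))// hk.
Qed.

(** Pairwise distances in an orthonormal family fixed by [K] are [sqrt 2], so
  the colouring of the unit ball at scale 1 separates its members: such families
  have bounded size, and a maximal one spans [N]. *)
Lemma compact_map_fixed_basis (K : H -> H) N : compact_map K -> subspace N ->
  (forall x, N x -> K x = x) -> exists n (u : 'I_n -> H),
    [/\ orthonormal_family u, forall i, N (u i) & forall x, N x -> ortho_part u x = x].
Proof.
move=> cK sN hK; have [F [k hk]] := cK 1 ltr01.
have bound n (u : 'I_n -> H) : orthonormal_family u -> (forall i, N (u i)) ->
    (n <= #|F|)%N.
  move=> ou Nu; rewrite -(card_ord n).
  have u1 i : nr (u i) = 1.
    have := ou i i; rewrite (ipxx hip) eqxx => /complexI/eqP.
    by rewrite sqrp_eq1 ?nr_ge0// => /eqP.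
  suff /leq_card : injective (k \o u) by [].
  move=> i j /= kij; apply/eqP; apply: contraT => ij.
  have u1' l : nr (u l) <= 1 by rewrite u1.
  have := hk _ _ (u1' i) (u1' j) kij.
  rewrite !hK// => h; have : nr (u i - u j) ^+ 2 <= 1.
    by rewrite -(expr1n _ 2) lerXn2r ?nnegrE ?nr_ge0.
  rewrite (nrB2 hip) !u1 /rip ou (negbTE ij) /=; lra.
suff : forall m, (exists n (u : 'I_n -> H), [/\ orthonormal_family u,
      forall i, N (u i) & forall x, N x -> ortho_part u x = x]) \/
    (exists u : 'I_m -> H, orthonormal_family u /\ forall i, N (u i)).
  move=> /(_ #|F|.+1)[//|[u [ou Nu]]].
  by have := bound _ _ ou Nu; rewrite ltnn.
elim=> [|m [|[u [ou Nu]]]]; [|by left|].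
  by right; exists (fun=> 0); split; case.
have [[x [Nx xu]]|h] := pselect (exists x, N x /\ ortho_part u x != x); last first.
  left; exists m, u; split => // x Nx; apply/eqP; apply: contraPP h => /negP h [].
  by exists x.
have [v [ov Nv _]] := extend_span ou xu; right; exists (extend u v); split => // i.
rewrite /extend; case: unlift => //; exact: Nv.
Qed.

End orthonormal_families.

(** * The Fredholm alternative *)

Section fredholm_alternative.
Variables (R : realType) (H : completeNormedModType R[i]).
Implicit Types (x y z : H).

(** With [v i] and [w] the solutions of [v + G v = b i] and [w + G w = y], a
  solution has the form [w - \sum_i c i *: v i], where the row [c] satisfies the
  square system [c *m (1 + M) = phi w] with [M i j = phi j (v i)]; injectivity
  makes this system regular. *)
Lemma finite_rank_perturbation (G : {linear H -> H}) (q : R) n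
    (phi : 'I_n -> {scalar H}) (b : 'I_n -> H) :
  0 <= q -> q < 1 -> (forall x, nr (G x) <= q * nr x) ->
  (forall x, x + G x + \sum_i phi i x *: b i = 0 -> x = 0) ->
  forall y, exists x, x + G x + \sum_i phi i x *: b i = y.
Proof.
move=> q0 q1 hG inj y.
have [v hv] : {v : 'I_n -> H & forall i, v i + G (v i) = b i}.
  apply: (@boolp.choice _ _ (fun i x => x + G x = b i)) => i.
  exact: neumann_surj q0 q1 hG _.
have [w hw] := neumann_surj q0 q1 hG y.
pose M : 'M[R[i]]_n := \matrix_(i, j) phi j (v i).
have phiv (c : 'rV[R[i]]_n) j : phi j (\sum_i c 0 i *: v i) = (c *m M) 0 j.
  rewrite linear_sum mxE; apply: eq_bigr => i _.
  by rewrite linearZ /= mxE.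
have Gv (c : 'rV[R[i]]_n) : \sum_i c 0 i *: v i + G (\sum_i c 0 i *: v i) =
    \sum_i c 0 i *: b i.
  rewrite linear_sum -big_split; apply: eq_bigr => i _ /=.
  by rewrite linearZ -scalerDr hv.
have AU : 1%:M + M \in unitmx.
  rewrite -row_free_unit; apply: inj_row_free => c; rewrite mulmxDr mulmx1 => cM.
  have cM' : c *m M = - c by apply/eqP; rewrite -addr_eq0 addrC cM.
  pose x := - \sum_i c 0 i *: v i.
  have phx j : phi j x = c 0 j by rewrite linearN /= phiv cM' mxE opprK.
  suff x0 : x = 0 by apply/rowP => j; rewrite -phx x0 linear0 mxE.
  apply: inj; under eq_bigr do rewrite phx.
  by rewrite linearN /= -opprD Gv addNr.
pose c := (\row_j phi j w) *m invmx (1%:M + M).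
have cE : c + c *m M = \row_j phi j w.
  by rewrite -[X in X + _]mulmx1 -mulmxDr mulmxKV.
pose x := w - \sum_i c 0 i *: v i; exists x.
have phx j : phi j x = c 0 j.
  have h : c 0 j + (c *m M) 0 j = phi j w.
    by transitivity ((c + c *m M) 0 j); [rewrite [RHS]mxE | rewrite cE mxE].
  by rewrite /x linearB /= phiv -h addrK.
under eq_bigr do rewrite phx.
by rewrite /x linearB /= addrACA -opprD Gv hw subrK.
Qed.

Variable (ip : {dot H for Num.conj}).
Hypothesis hip : induces_norm ip.

Lemma ipl_is_linear (a : H) : scalar (ip^~ a).
Proof. by move=> c x y; rewrite linearPl. Qed.

Definition ipl (a : H) : {scalar H} :=
  HB.pack (ip^~ a) (GRing.isLinear.Build _ _ _ _ (ip^~ a) (ipl_is_linear a)).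

(** A compact operator is a finite-rank one up to an operator of norm less than
  1, which a Neumann series absorbs; what is left is a square linear system. *)
Theorem fredholm_alternative (K : {linear H -> H}) (I : finType) (a b : I -> H) :
  compact_map K ->
  (forall x, x + K x + \sum_i ip x (a i) *: b i = 0 -> x = 0) ->
  forall y, exists x, x + K x + \sum_i ip x (a i) *: b i = y.
Proof.
move=> cK inj; have half_gt0 : (0 : R) < 1 / 2 by rewrite divr_gt0.
have [n [u [ou hu]]] := compact_map_approx hip cK half_gt0.
pose J := ('I_n + I)%type.
pose phiJ (j : J) : {scalar H} :=
  match j with inl i => (ipl (u i) \o K : {scalar H}) | inr i => ipl (a i) end.
pose bJ (j : J) := match j with inl i => u i | inr i => b i end.
have l : linear (fun x => K x - ortho_part ip u (K x)).
  by move=> c y z; rewrite !linearP /= scalerDr addrACA.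
pose G : {linear H -> H} := HB.pack (fun x => K x - ortho_part ip u (K x))
  (GRing.isLinear.Build _ _ _ _ _ l).
have E x : x + G x +
    \sum_(i < #|{: J}|) phiJ (enum_val i) x *: bJ (enum_val i) =
    x + K x + \sum_i ip x (a i) *: b i.
  have -> : \sum_(i < #|{: J}|) phiJ (enum_val i) x *: bJ (enum_val i) =
      \sum_(j : J) phiJ j x *: bJ j.
    by rewrite [RHS](reindex (@enum_val J predT))//; exact/onW_bij/enum_val_bij.
  rewrite big_sumType /= -/(ortho_part ip u (K x)).
  by rewrite addrA; congr (_ + _); rewrite addrA subrK.
have q1 : (1 / 2 : R) < 1 by lra.
move=> y; have [x|x xE] := @finite_rank_perturbation G (1 / 2) #|{: J}|
  (fun i => phiJ (enum_val i)) (fun i => bJ (enum_val i)) (ltW half_gt0) q1 hu _ y.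
- by rewrite E; exact: inj.
- by exists x; rewrite -xE E.
Qed.

End fredholm_alternative.

(** * Codimension *)

Section codimension.
Variables (R : realType) (H : completeNormedModType R[i]).
Implicit Types (M N : set H).

(** Expressing each family in terms of the other gives two matrices whose product
  is the identity. *)
Lemma codim_le M N n m : subspace M -> has_codim M N n -> has_codim M N m ->
  (n <= m)%N.
Proof.
move=> sM [b [Nb hb]] [b' [Nb' hb']].
have [C hC] : {C : 'I_n -> 'rV[R[i]]_m &
    forall i, M (b i - \sum_j C i 0 j *: b' j)}.
  apply: (@boolp.choice _ _ (fun i (c : 'rV[R[i]]_m) => M (b i - \sum_j c 0 j *: b' j))) => i.
  by have [c [hc _]] := hb' _ (Nb i); exists c.
have [D hD] : {D : 'I_m -> 'rV[R[i]]_n &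
    forall i, M (b' i - \sum_j D i 0 j *: b j)}.
  apply: (@boolp.choice _ _ (fun i (c : 'rV[R[i]]_n) => M (b' i - \sum_j c 0 j *: b j))) => i.
  by have [c [hc _]] := hb _ (Nb' i); exists c.
pose Cm : 'M[R[i]]_(n, m) := \matrix_(i, j) (C i) 0 j.
pose Dm : 'M[R[i]]_(m, n) := \matrix_(i, j) D i 0 j.
apply: (@mulmx1_min _ n m Cm Dm); apply/row_matrixP => i; rewrite row_mul.
have [c [_ uniq_c]] := hb _ (Nb i).
rewrite -[LHS]uniq_c; first apply: uniq_c.
- have -> : b i - \sum_j row i 1%:M 0 j *: b j = 0; last by case: sM.
  rewrite (bigD1 i)//= big1 => [|j ji]; last first.
    by rewrite !mxE eq_sym (negbTE ji) scale0r.
  by rewrite !mxE eqxx scale1r addr0 subrr.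
- have -> : b i - \sum_j (row i Cm *m Dm) 0 j *: b j =
      (b i - \sum_j C i 0 j *: b' j) +
      \sum_k C i 0 k *: (b' k - \sum_j D k 0 j *: b j).
    have -> : \sum_j (row i Cm *m Dm) 0 j *: b j =
        \sum_k C i 0 k *: \sum_j D k 0 j *: b j.
      under eq_bigr do rewrite mxE scaler_suml.
      rewrite exchange_big; apply: eq_bigr => k _; rewrite scaler_sumr.
      by apply: eq_bigr => j _; rewrite !mxE scalerA.
    under [X in _ = _ + X]eq_bigr do rewrite scalerBr.
    by rewrite sumrB addrA subrK.
  by apply: subspaceD => //; apply: subspace_sum => // k; apply: subspaceZ.
Qed.

Lemma has_codim_codim M N n : subspace M -> has_codim M N n -> codim M N = n.
Proof.
move=> sM h; rewrite /codim; case: xgetP => [k _ /= hk|/(_ n)//].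
by apply/eqP; rewrite eqn_leq (codim_le sM hk h) (codim_le sM h hk).
Qed.

Lemma subspace0 : subspace [set (0 : H)].
Proof. by split => // a x y -> ->; rewrite scaler0 addr0. Qed.

Lemma closed_kernel (T : {linear H -> H}) (c : R) :
  (forall x, nr (T x) <= c * nr x) -> closed [set x | T x = 0].
Proof.
move=> hT x clx /=; apply/nr_eq0/le_anti; rewrite nr_ge0 andbT.
apply/ler_addgt0Pl => e e0; rewrite addr0.
pose c' := `|c| + 1; have c'0 : 0 < c' by rewrite ltr_wpDl.
have p : (0 : R[i]) < (e / c')%:C%C by rewrite ltcR divr_gt0.
have [y [/= Ty]] := clx _ (nbhsx_ballx x _ p).
rewrite -ball_normE /= normE ltcR => xy.
have -> : T x = T (x - y) by rewrite linearB /= Ty subr0.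
rewrite (le_trans (hT _))// (@le_trans _ _ (c' * nr (x - y)))//.
  by rewrite ler_wpM2r ?nr_ge0// (le_trans (ler_norm _))// lerDl.
by rewrite mulrC -ler_pdivlMr// ltW.
Qed.

End codimension.

(** * Fredholm pairs of projections *)

Section pairs.
Variables (R : realType) (H : completeNormedModType R[i]).
Variable (ip : {dot H for Num.conj}).
Implicit Types (x y z : H) (N : set H) (P Q : {linear H -> H}).

Definition ortho_basis N n (e : 'I_n -> H) : Prop :=
  [/\ orthonormal_family ip e, forall i, N (e i) &
      forall x, N x -> ortho_part ip e x = x].

Lemma ortho_basis_has_dim N n (e : 'I_n -> H) :
  ortho_basis N e -> has_codim [set 0] N n.
Proof.
move=> [oe Ne he]; exists e; split => // x Nx.
exists (\row_i ip x (e i)); split => [|c /= /eqP].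
  rewrite -{1}(he _ Nx) /ortho_part /=.
  by under [in X in _ - X]eq_bigr do rewrite mxE; rewrite subrr.
rewrite subr_eq0 => /eqP xE; apply/rowP => i.
by rewrite mxE xE ip_comb.
Qed.

Lemma ortho_basis_dim N n (e : 'I_n -> H) : ortho_basis N e -> dimension N = n.
Proof.
by move=> h; apply/has_codim_codim/(ortho_basis_has_dim h); exact: subspace0.
Qed.

(** The kernel of [Q] on [Ran P]. The difference [P - Q] fixes its vectors, so it
  is finite-dimensional as soon as [P - Q] is compact. *)
Definition defect P Q : set H := [set x | P x = x /\ Q x = 0].

Lemma subspace_defect P Q : subspace (defect P Q).
Proof.
split; first by split; rewrite linear0.
move=> a x y [Px Qx] [Py Qy]; split; rewrite linearP ?Px ?Py// Qx Qy.
by rewrite scaler0 addr0.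
Qed.

Hypothesis hip : induces_norm ip.

Lemma proj_rip P x y : orthogonal_projection ip P -> rip ip (P x) y = rip ip x (P y).
Proof. by move=> [_ sP _]; rewrite /rip sP. Qed.

Lemma proj_nr2 P x : orthogonal_projection ip P -> rip ip (P x) x = nr (P x) ^+ 2.
Proof.
by move=> hP; have [_ _ PP] := hP; rewrite -(ripxx hip) -proj_rip// PP.
Qed.

Lemma proj_nr P x : orthogonal_projection ip P -> nr (P x) <= nr x.
Proof.
move=> hP; have := cauchy_schwarz hip (P x) x; rewrite proj_nr2// expr2.
have [->|Px] := eqVneq (nr (P x)) 0; first by rewrite nr_ge0.
by rewrite ler_pM2l// lt_def Px nr_ge0.
Qed.

Lemma proj_pythagoras P x : orthogonal_projection ip P ->
  nr x ^+ 2 = nr (P x) ^+ 2 + nr (x - P x) ^+ 2.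
Proof. by move=> hP; rewrite (nrB2 hip) ripC proj_nr2//; ring. Qed.

Lemma proj_rangeE P : orthogonal_projection ip P -> range P = [set x | P x = x].
Proof.
move=> [_ _ PP]; apply/seteqP; split => x /=; first by move=> [y _ <-]; exact: PP.
by move=> Px; exists x.
Qed.

Lemma defect_basis P Q : compact_map (fun x => P x - Q x) ->
  exists n (e : 'I_n -> H), ortho_basis (defect P Q) e.
Proof.
move=> c; apply: (compact_map_fixed_basis hip c); first exact: subspace_defect.
by move=> x [-> ->]; rewrite subr0.
Qed.

Lemma compact_map_swap P Q : compact_map (fun x => P x - Q x) ->
  compact_map (fun x => Q x - P x).
Proof. move/compact_mapN; apply: eq_compact_map => x; by rewrite opprB. Qed.

(** On [Ran Q] the operator [Q P Q = Q - Q (1 - P) Q] is a compact perturbation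
  of the identity, and its kernel is [defect Q P]; adding the projection onto
  this finite-dimensional kernel makes it injective, hence surjective. *)
Lemma image_proj_pair P Q m (f : 'I_m -> H) :
  orthogonal_projection ip P -> orthogonal_projection ip Q ->
  compact_map (fun x => P x - Q x) -> ortho_basis (defect Q P) f ->
  (Q \o P) @` range P = [set y | Q y = y] `&` [set y | ortho_part ip f y = 0].
Proof.
move=> hP hQ cPQ [of_ Nf hf].
have [_ sP PP] := hP; have [_ sQ QQ] := hQ.
have QPf x i : ip (Q (P x)) (f i) = 0.
  by have [Qf Pf] := Nf i; rewrite sQ Qf sP Pf linear0r.
have fQP x : ortho_part ip f (Q (P x)) = 0.
  by rewrite /ortho_part big1// => i _; rewrite QPf scale0r.
have Qpart x : Q (ortho_part ip f x) = ortho_part ip f x.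
  rewrite linear_sum; apply: eq_bigr => i _.
  by rewrite linearZ /=; have [-> _] := Nf i.
apply/seteqP; split => y.
  by move=> [_ [x _ <-] <-] /=; rewrite PP QQ fQP.
move=> [/= Qy fy].
have l : linear (fun x => Q (P (Q x) - Q (Q x))).
  by move=> a u v; rewrite -linearP; congr (Q _); rewrite !linearP /= scalerDr addrACA.
pose K : {linear H -> H} := HB.pack (fun x => Q (P (Q x) - Q (Q x)))
  (GRing.isLinear.Build _ _ _ _ _ l).
have cK : compact_map K.
  apply: (@compact_map_compl _ _ Q (fun x => P (Q x) - Q (Q x)) 1).
    by move=> x; rewrite mul1r proj_nr.
  by apply: (compact_map_compr (fun x => proj_nr x hQ) cPQ).
have KE z : z + K z + \sum_i ip z (f i) *: f i = z - Q z + Q (P (Q z)) + ortho_part ip f z.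
  by rewrite /K /= linearB /= !QQ addrA addrAC.
have solve z w : Q w = w -> z + K z + \sum_i ip z (f i) *: f i = w ->
    Q z = z /\ Q (P (Q z)) + ortho_part ip f z = w.
  move=> Qw; rewrite KE -addrA; set s := Q (P (Q z)) + _ => zE.
  have Qs : Q s = s by rewrite linearD /= QQ Qpart.
  have sw : s = w by rewrite -Qw -zE linearD /= linearB /= QQ subrr add0r.
  split => //; apply/eqP; rewrite eq_sym -subr_eq0; apply/eqP.
  by apply: (addIr s); rewrite zE add0r.
have inj z : z + K z + \sum_i ip z (f i) *: f i = 0 -> z = 0.
  move=> /solve[|Qz]; first exact: linear0.
  rewrite Qz => zE.
  have fz : ortho_part ip f z = 0.
    have := congr1 (ortho_part ip f) zE.
    by rewrite linear0 linearD /= fQP add0r ortho_part_id.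
  move: zE; rewrite fz addr0 => QPz.
  have Pz : P z = 0.
    apply: nr_eq0; apply/eqP; rewrite -sqrf_eq0 -proj_nr2// -{2}Qz.
    by rewrite -(proj_rip _ _ hQ) QPz rip0l.
  by rewrite -(hf z) ?fz.
have [z /solve[//|Qz zE]] := fredholm_alternative hip cK inj y.
rewrite Qz in zE.
have fz : ortho_part ip f z = 0.
  by have := congr1 (ortho_part ip f) zE; rewrite linearD /= fQP add0r ortho_part_id// fy.
exists (P z); first by exists z.
by rewrite /= PP -zE fz addr0.
Qed.

Lemma fredholm_pairP P Q n m (e : 'I_n -> H) (f : 'I_m -> H) :
  orthogonal_projection ip P -> orthogonal_projection ip Q ->
  compact_map (fun x => P x - Q x) ->
  ortho_basis (defect P Q) e -> ortho_basis (defect Q P) f ->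
  fredholm_pair P Q /\ pair_index P Q = n%:Z - m%:Z.
Proof.
move=> hP hQ cPQ be bf; have [of_ Nf hf] := bf.
have [_ sP PP] := hP; have [_ sQ QQ] := hQ.
have kerE : ker_on (Q \o P) (range P) = defect P Q.
  rewrite /ker_on proj_rangeE//; apply/seteqP; split => x [/= Px].
    by rewrite /op_ker /= Px.
  by move=> Qx; split; rewrite // /op_ker /= Px.
have imE := image_proj_pair hP hQ cPQ bf.
have codimE : has_codim ((Q \o P) @` range P) (range Q) m.
  exists f; split => [i|x].
    by rewrite proj_rangeE//; case: (Nf i).
  rewrite proj_rangeE// imE /= => Qx.
  exists (\row_i ip x (f i)); split => [|c [_ /= hc]].
    under eq_bigr do rewrite mxE.
    rewrite -/(ortho_part ip f x); split; last first.
      by rewrite linearB /= ortho_part_id// subrr.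
    rewrite linearB /= Qx; congr (_ - _); rewrite linear_sum.
    by apply: eq_bigr => i _; rewrite linearZ /=; have [-> _] := Nf i.
  apply/rowP => i; rewrite mxE; apply/eqP; rewrite -subr_eq0; apply/eqP.
  have := congr1 (fun y => ip y (f i)) hc.
  by rewrite /= ip_ortho_part// linear0l linearBl /= ip_comb.
have s : subspace ((Q \o P) @` range P).
  rewrite imE; split; first by split; rewrite /= linear0.
  move=> a x y [/= Qx fx] [/= Qy fy]; split; rewrite /= linearP ?Qx ?Qy//.
  by rewrite /= fx fy scaler0 addr0.
split; last first.
  by rewrite /pair_index /fredholm_index kerE (ortho_basis_dim be) (has_codim_codim s codimE).
split.
- by move=> _ [_ [x _ <-] <-]; exists (P (P x)).
- by rewrite kerE; exists n; exact: ortho_basis_has_dim be.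
- rewrite imE; apply: closedI.
    have l : linear (fun x => Q x - x).
      by move=> a x y; rewrite linearP /= scalerBr opprD addrACA.
    pose D : {linear H -> H} := HB.pack (fun x => Q x - x)
      (GRing.isLinear.Build _ _ _ _ _ l).
    have -> : [set y | Q y = y] = [set x | D x = 0].
      apply/seteqP; split => x /=; first by move=> ->; rewrite subrr.
      by move=> /eqP; rewrite subr_eq0 => /eqP.
    apply: (@closed_kernel _ _ D 2) => x /=; rewrite (le_trans (nrB _ _))//.
    by rewrite mulr_natl mulr2n lerD ?proj_nr.
  apply: (@closed_kernel _ _ (ortho_part ip f) 2) => x /=.
  rewrite -[ortho_part ip f x](subKr x) (le_trans (nrB _ _))//.
  by rewrite mulr_natl mulr2n lerD ?nr_ortho_rest.
- by exists m.
Qed.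

End pairs.

(** * Additivity of the index *)

Section index_additivity.
Variables (R : realType) (H : completeNormedModType R[i]).
Variable (ip : {dot H for Num.conj}).
Hypothesis hip : induces_norm ip.
Implicit Types (x y z : H) (N : set H) (P Q : {linear H -> H}).

(** [x |-> \sum_j Q_j P_j x] is a compact perturbation of the identity, with the
  sum of the [defect P_j Q_j] as kernel and the sum of the [defect Q_j P_j] as
  orthogonal of its range. Were all the inequalities true and one of them
  strict, a finite-rank correction would make it injective, not surjective. *)
Lemma defect_dim_eq k (P Q : 'I_k -> {linear H -> H}) (n m : 'I_k -> nat)
    (e : forall j, 'I_(n j) -> H) (f : forall j, 'I_(m j) -> H) :
  (forall j, orthogonal_projection ip (P j)) ->
  (forall j, orthogonal_projection ip (Q j)) ->
  (forall x, \sum_j P j x = x) ->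
  (forall i j x, i != j -> Q i (Q j x) = 0) ->
  (forall j, compact_map (fun x => P j x - Q j x)) ->
  (forall j, ortho_basis ip (defect (P j) (Q j)) (e j)) ->
  (forall j, ortho_basis ip (defect (Q j) (P j)) (f j)) ->
  (forall j, (n j <= m j)%N) -> forall j, n j = m j.
Proof.
move=> hP hQ sumP QQ0 cPQ be bf nm j.
apply/eqP; rewrite eqn_leq nm leqNgt; apply/negP => ltnm.
have QQ i x : Q i (Q i x) = Q i x by have [_ _ ->] := hQ i.
have Qf i l : Q i (f i l) = f i l by have [_ /(_ l)[]] := bf i.
have Pf i l : P i (f i l) = 0 by have [_ /(_ l)[]] := bf i.
have Pe i l : P i (e i l) = e i l by have [_ /(_ l)[]] := be i.
have sQ i x y : ip (Q i x) y = ip x (Q i y) by have [_ ->] := hQ i.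
have sP i x y : ip (P i x) y = ip x (P i y) by have [_ ->] := hP i.
have l : linear (fun x => \sum_i (Q i (P i x) - P i x)).
  move=> a x y; rewrite scaler_sumr -big_split; apply: eq_bigr => i _.
  by rewrite !linearP /= scalerDr addrACA.
pose K : {linear H -> H} := HB.pack (fun x => \sum_i (Q i (P i x) - P i x))
  (GRing.isLinear.Build _ _ _ _ _ l).
have cK : compact_map K.
  apply: compact_map_sum => i.
  have cPQi := compact_map_compr (fun x => proj_nr hip x (hP i)) (compact_map_swap (cPQ i)).
  by apply: eq_compact_map cPQi => x /=; have [_ _ ->] := hP i.
pose J := {i : 'I_k & 'I_(n i)}.
pose a (t : J) := e (tag t) (tagged t).
pose b (t : J) := f (tag t) (widen_ord (nm (tag t)) (tagged t)).
have WE x : x + K x + \sum_(t : J) ip x (a t) *: b t =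
    \sum_i (Q i (P i x) + \sum_(l < n i) ip x (e i l) *: f i (widen_ord (nm i) l)).
  rewrite big_split /= sumrB sumP addrCA subrr addr0; congr (_ + _).
  by rewrite (sig_big_dep _ _ (fun i (l : 'I_(n i)) =>
    ip x (e i l) *: f i (widen_ord (nm i) l))).
have QW i x : Q i (x + K x + \sum_(t : J) ip x (a t) *: b t) =
    Q i (P i x) + \sum_(l < n i) ip x (e i l) *: f i (widen_ord (nm i) l).
  rewrite WE linear_sum (bigD1 i)//= [X in _ + X]big1 ?addr0 => [|i' i'i].
    rewrite linearD /= QQ linear_sum; congr (_ + _); apply: eq_bigr => t _.
    by rewrite linearZ /= Qf.
  rewrite linearD /= QQ0 1?eq_sym// add0r linear_sum big1// => t _.
  by rewrite linearZ /= -Qf QQ0 1?eq_sym// scaler0.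
have QPf i x t : ip (Q i (P i x)) (f i t) = 0.
  by rewrite sQ Qf sP Pf linear0r.
have inj x : x + K x + \sum_(t : J) ip x (a t) *: b t = 0 -> x = 0.
  move=> W0; rewrite -(sumP x) big1// => i _.
  have := QW i x; rewrite W0 linear0 => /esym Qi0.
  have xe t : ip x (e i t) = 0.
    have := congr1 (fun y => ip y (f i (widen_ord (nm i) t))) Qi0.
    rewrite /= linear0l linearDl /= QPf add0r ip_suml (bigD1 t)//= big1 => [|t' tt'].
      rewrite addr0 linearZl_LR /=; have [of_ _ _] := bf i.
      by rewrite of_ eqxx mulr1.
    have [of_ _ _] := bf i.
    by rewrite linearZl_LR /= of_ -val_eqE /= val_eqE (negbTE tt') mulr0.
  have [_ _ he] := be i.
  rewrite -(he (P i x)).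
    by rewrite /ortho_part big1// => t _; rewrite sP Pe xe scale0r.
  split; first by have [_ _ ->] := hP i.
  rewrite -Qi0 [X in _ + X]big1 ?addr0// => t _.
  by rewrite xe scale0r.
(* the correction does not reach the members of [f j] of index [n j] and more *)
pose g := f j (Ordinal ltnm).
have [x xE] := fredholm_alternative hip cK inj g.
have := congr1 (fun y => ip (Q j y) g) xE; rewrite /= QW.
have [of_ _ _] := bf j.
rewrite Qf of_ eqxx linearDl /= QPf add0r ip_suml big1 => [/esym/eqP|t _].
  by rewrite oner_eq0.
rewrite linearZl_LR /= of_ -val_eqE /=.
by rewrite ltn_eqF ?mulr0.
Qed.

(** [index_zero] records both dimensions by orthonormal bases indexed by the same
  ['I_n], so finiteness is part of it. *)
Definition index_zero P Q : Prop := exists n (e f : 'I_n -> H),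
  ortho_basis ip (defect P Q) e /\ ortho_basis ip (defect Q P) f.

Lemma index_zero_basis P Q n m (e : 'I_n -> H) (f : 'I_m -> H) :
  index_zero P Q -> ortho_basis ip (defect P Q) e ->
  ortho_basis ip (defect Q P) f -> n = m.
Proof.
move=> [k [e' [f' [be' bf']]]] be bf.
rewrite -(ortho_basis_dim be) -(ortho_basis_dim bf).
by rewrite (ortho_basis_dim be') (ortho_basis_dim bf').
Qed.

(** The index of a pair is additive over orthogonal decompositions, and the
  pair of identities has index zero. *)
Lemma index_zero_complement k (P Q : 'I_k -> {linear H -> H}) (j : 'I_k) :
  (forall j, orthogonal_projection ip (P j)) ->
  (forall j, orthogonal_projection ip (Q j)) ->
  (forall x, \sum_j P j x = x) -> (forall x, \sum_j Q j x = x) ->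
  (forall i j x, i != j -> P i (P j x) = 0) ->
  (forall i j x, i != j -> Q i (Q j x) = 0) ->
  (forall j, compact_map (fun x => P j x - Q j x)) ->
  (forall i, i != j -> index_zero (P i) (Q i)) -> index_zero (P j) (Q j).
Proof.
move=> hP hQ sumP sumQ PP0 QQ0 cPQ h0.
have cQP i := compact_map_swap (cPQ i).
have [n hn] : {n : 'I_k -> nat & forall i, exists e : 'I_(n i) -> H,
    ortho_basis ip (defect (P i) (Q i)) e}.
  apply: (@boolp.choice _ _ (fun i n => exists e : 'I_n -> H,
    ortho_basis ip (defect (P i) (Q i)) e)).
  by move=> i; exact: defect_basis.
have [m hm] : {n : 'I_k -> nat & forall i, exists e : 'I_(n i) -> H,
    ortho_basis ip (defect (Q i) (P i)) e}.
  apply: (@boolp.choice _ _ (fun i n => exists e : 'I_n -> H,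
    ortho_basis ip (defect (Q i) (P i)) e)).
  by move=> i; exact: defect_basis.
pose e i := projT1 (cid (hn i)).
have he i : ortho_basis ip (defect (P i) (Q i)) (e i) by exact: projT2 (cid (hn i)).
pose f i := projT1 (cid (hm i)).
have hf i : ortho_basis ip (defect (Q i) (P i)) (f i) by exact: projT2 (cid (hm i)).
have nm i : i != j -> n i = m i.
  by move=> ij; exact: index_zero_basis (h0 _ ij) (he i) (hf i).
have nmj : n j = m j.
  have [le_nm|/ltnW le_mn] := leqP (n j) (m j).
    apply: (defect_dim_eq hP hQ sumP QQ0 cPQ he hf) => i.
    by have [->//|/nm ->] := eqVneq i j.
  apply/esym/(defect_dim_eq hQ hP sumQ PP0 cQP hf he) => i.
  by have [->//|/nm ->] := eqVneq i j.
move: (he j) (hf j); move: (e j) (f j); rewrite -nmj => e' f' he' hf'.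
by exists (n j), e', f'.
Qed.

Lemma index_zero_defect0 P Q : (forall x, defect P Q x -> x = 0) ->
  (forall x, defect Q P x -> x = 0) -> index_zero P Q.
Proof.
move=> h1 h2; exists 0%N, (fun=> 0), (fun=> 0); split; split; try by case.
  by move=> x /h1 ->; rewrite linear0.
by move=> x /h2 ->; rewrite linear0.
Qed.

Lemma ker_proj_perp P Q :
  orthogonal_projection ip P -> orthogonal_projection ip Q ->
  op_ker (fun x => P (op_perp Q x) - x) = defect P Q.
Proof.
move=> hP hQ; apply/seteqP; split => x; rewrite /op_ker /op_perp /=.
  move=> /eqP; rewrite subr_eq0 => /eqP PQx.
  have Qx : Q x = 0.
    apply: nr_eq0; apply/eqP; rewrite -sqrf_eq0.
    have := proj_pythagoras hip x hQ; have := proj_nr hip (x - Q x) hP; rewrite PQx.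
    have := nr_ge0 x; have := nr_ge0 (x - Q x); have := sqr_ge0 (nr (Q x)).
    move: (nr x) (nr (x - Q x)) (nr (Q x)) => u v w hw hv hu uv E.
    apply/eqP; nra.
  by split => //; rewrite -{2}PQx Qx subr0.
by move=> [Px Qx]; rewrite Qx subr0 Px subrr.
Qed.

Lemma ker_perp_proj P Q :
  orthogonal_projection ip P -> orthogonal_projection ip Q ->
  op_ker (fun x => op_perp P (Q x) - x) = defect Q P.
Proof.
move=> hP hQ; apply/seteqP; split => x; rewrite /op_ker /op_perp /=.
  move=> /eqP; rewrite subr_eq0 => /eqP PQx.
  have PQ0 : P (Q x) = 0.
    apply: nr_eq0; apply/eqP; rewrite -sqrf_eq0.
    have := proj_pythagoras hip (Q x) hP; have := proj_nr hip x hQ; rewrite PQx.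
    have := nr_ge0 x; have := nr_ge0 (Q x); have := sqr_ge0 (nr (P (Q x))).
    move: (nr x) (nr (Q x)) (nr (P (Q x))) => u v w hw hv hu uv E.
    apply/eqP; nra.
  by move: PQx; rewrite PQ0 subr0 => Qx; split; rewrite // -Qx.
by move=> [Qx Px]; rewrite Qx Px subr0 subrr.
Qed.

Lemma index_zero_fredholm P Q :
  orthogonal_projection ip P -> orthogonal_projection ip Q ->
  compact_map (fun x => P x - Q x) -> index_zero P Q ->
  [/\ fredholm_pair P Q, pair_index P Q = 0,
      finite_dimensional (op_ker (fun x => P (op_perp Q x) - x)),
      finite_dimensional (op_ker (fun x => op_perp P (Q x) - x))
    & dimension (op_ker (fun x => P (op_perp Q x) - x)) =
      dimension (op_ker (fun x => op_perp P (Q x) - x))].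
Proof.
move=> hP hQ cPQ [n [e [f [be bf]]]].
rewrite ker_proj_perp// ker_perp_proj//.
have [F I0] := fredholm_pairP hip hP hQ cPQ be bf.
rewrite (ortho_basis_dim be) (ortho_basis_dim bf) I0 subrr; split => //.
- by exists n; exact: ortho_basis_has_dim be.
- by exists n; exact: ortho_basis_has_dim bf.
Qed.

End index_additivity.

(** * Projection-valued measures *)

Section pvm.
Variables (R : realType) (H : completeNormedModType R[i]).
Variable (ip : {dot H for Num.conj}).
Hypothesis hip : induces_norm ip.
Implicit Types (x y z : H).
Local Notation borel := (measurableTypeR R).
Variable (E : set borel -> {linear H -> H}).
Hypothesis hE : bounded_pvm ip E.
Implicit Types (D : set borel).

Lemma pvm_proj D : measurable D -> orthogonal_projection ip (E D).
Proof. by case: hE => h _ _ _; exact: h. Qed.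

Lemma pvm_set0 x : E set0 x = 0.
Proof. by case: hE. Qed.

Lemma pvmU D D' x : measurable D -> measurable D' -> D `&` D' = set0 ->
  E (D `|` D') x = E D x + E D' x.
Proof.
move=> mD mD' DD'; have [_ _ _ sigma] := hE.
have mF n : measurable (bigcup2 D D' n) by case: n => [|[|n]] /=.
have tF : trivIset setT (bigcup2 D D') by rewrite -trivIset_bigcup2.
have := sigma _ mF tF x; rewrite bigcup2E => h.
apply: (cvg_unique (@norm_hausdorff _ _) h).
apply: cvg_near_cst; exists 2%N => // -[|[|n]] //= _.
rewrite big_nat_recl// big_nat_recl//= big1 ?addr0// => i _.
exact: pvm_set0.
Qed.

Lemma pvm_idem D x : measurable D -> E D (E D x) = E D x.
Proof. by move=> mD; have [_ _ ->] := pvm_proj mD. Qed.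

(** The sum [p + q] is the projection [E (D `|` D')], so [p q + q p = 0]; then
  [p q = - p q p = q p], and both vanish. *)
Lemma pvm_disjoint D D' x : measurable D -> measurable D' ->
  D `&` D' = set0 -> E D (E D' x) = 0.
Proof.
move=> mD mD' DD'; set p := E D; set q := E D'.
have pp z : p (p z) = p z by exact: pvm_idem.
have qq z : q (q z) = q z by exact: pvm_idem.
have anti z : p (q z) + q (p z) = 0.
  have := pvm_idem z (measurableU _ _ mD mD').
  rewrite !pvmU// -/p -/q !linearD /= pp qq [q (p z) + _]addrC addrACA => h.
  by apply: (addrI (p z + q z)); rewrite addr0 -{2}h addrACA [q z + _]addrC -addrACA.
have h1 : p (q x) = - q (p x) by apply/eqP; rewrite -addr_eq0 anti.
have h2 : p (q x) = - p (q (p x)).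
  by rewrite -{1}(pp (q x)) h1 linearN.
have h3 : p (q (p x)) = - q (p x).
  by apply/eqP; rewrite -addr_eq0; have := anti (p x); rewrite pp => ->.
have : p (q x) + p (q x) = 0 by rewrite {1}h2 h3 h1 opprK subrr.
rewrite -mulr2n -scaler_nat => /eqP; rewrite scaler_eq0 pnatr_eq0 /=.
by move/eqP.
Qed.

Lemma pvmI D D' x : measurable D -> measurable D' ->
  E D (E D' x) = E (D `&` D') x.
Proof.
move=> mD mD'.
have mI := measurableI _ _ mD mD'.
have m1 := measurableD mD mD'; have m2 := measurableD mD' mD.
have d1 : (D `&` D') `&` (D `\` D') = set0.
  by apply/seteqP; split => t //= -[[_ ?] []].
have d2 : (D `&` D') `&` (D' `\` D) = set0.
  by apply/seteqP; split => t //= -[[? _] []].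
have d3 : D `&` (D' `\` D) = set0.
  by apply/seteqP; split => t //= -[? []].
have e1 z : E D z = E (D `&` D') z + E (D `\` D') z.
  by rewrite -pvmU ?setUIDK.
have e2 z : E D' z = E (D `&` D') z + E (D' `\` D) z.
  by rewrite -pvmU// [D `&` D']setIC setUIDK.
rewrite e2 linearD /= (pvm_disjoint x mD m2 d3) addr0 e1 pvm_idem//.
by rewrite (pvm_disjoint x m1 mI) ?addr0// setIC.
Qed.

Lemma pvmT x : E setT x = x.
Proof.
have [_ _ [a ha] _] := hE.
by rewrite -{1}(ha x) pvmI// setTI ha.
Qed.

Lemma pvmC D x : measurable D -> E (~` D) x = x - E D x.
Proof.
move=> mD; rewrite -{2}(pvmT x) -(setUv D) pvmU ?setICr//; last exact: measurableC.
by rewrite addrC addKr.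
Qed.

Lemma pvm_sub D D' x : measurable D -> measurable D' -> D `<=` D' ->
  E D x = x -> E D' x = x.
Proof.
by move=> mD mD' DD' Dx; rewrite -{1}Dx pvmI// setIC ((setIidPl _ _).2 DD').
Qed.

Lemma pvm_sub0 D D' x : measurable D -> measurable D' -> D `<=` D' ->
  E D' x = 0 -> E D x = 0.
Proof.
by move=> mD mD' DD' Dx; rewrite -((setIidPl _ _).2 DD') -pvmI// Dx linear0.
Qed.

Lemma pvm_comm x D D' : measurable D -> measurable D' ->
  E D (E D' x) = E D' (E D x).
Proof. by move=> mD mD'; rewrite !pvmI// setIC. Qed.

Lemma pvm_supp : exists2 a : R, 0 < a & forall x, E `]- a, a[%classic x = x.
Proof.
have [_ _ [a ha] _] := hE; exists (`|a| + 1) => [|x]; first by rewrite ltr_wpDl.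
apply: (pvm_sub _ _ _ (ha x)) => // t /=; rewrite !in_itv /=.
have a1 := ler_norm a; move=> /andP[? ?]; apply/andP; split; lra.
Qed.

(** [<E(D) x, x>], cut off to 0 on the sets [D] that are not Borel, where it
  could be negative. *)
Definition spectral_mass x D : \bar R :=
  (if `[< measurable D >] then rip ip (E D x) x else 0)%:E.

Lemma spectral_massE x D : measurable D ->
  spectral_mass x D = (nr (E D x) ^+ 2)%:E.
Proof.
by move=> mD; rewrite /spectral_mass asboolT// (proj_nr2 hip _ (pvm_proj mD)).
Qed.

Lemma spectral_mass_scalar x D : measurable D ->
  spectral_mass x D = scalar_measure ip E x D.
Proof. by move=> mD; rewrite /spectral_mass asboolT. Qed.

Lemma spectral_mass0 x : spectral_mass x set0 = 0%E.
Proof. by rewrite spectral_massE// pvm_set0 nr0 expr0n. Qed.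

Lemma spectral_mass_ge0 x D : (0 <= spectral_mass x D)%E.
Proof.
rewrite /spectral_mass lee_fin; case: asboolP => // mD.
by rewrite (proj_nr2 hip _ (pvm_proj mD)) sqr_ge0.
Qed.

Lemma spectral_mass_sigma x : semi_sigma_additive (spectral_mass x).
Proof.
move=> F mF tF mUF; have [_ _ _ /(_ F mF tF x) cF] := hE.
have -> : (fun n => (\sum_(0 <= i < n) spectral_mass x (F i))%E) =
    (fun n => (rip ip (\sum_(0 <= i < n) E (F i) x) x)%:E).
  apply/funext => n; elim: n => [|n IH]; first by rewrite !big_geq// rip0l.
  rewrite !big_nat_recr//= IH spectral_mass_scalar// ripDl EFinD.
  by rewrite /scalar_measure.
rewrite spectral_mass_scalar//; apply/fine_cvgP; split; first by near=> n.
apply/cvgrPdist_le => e e0 /=.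
pose c := nr x + 1; have c0 : 0 < c by rewrite ltr_wpDl ?nr_ge0.
have p : (0 : R[i]) < (e / c)%:C%C by rewrite ltcR divr_gt0.
have /cvgrPdist_lt /(_ _ p) := cF; apply: filterS => n /=.
rewrite normE ltcR => h; rewrite -/(rip ip _ _) -ripBl.
set z := (_ - _) in h *.
apply: (@le_trans _ _ (nr z * nr x)).
  by rewrite ler_norml (ripN_le hip)// (cauchy_schwarz hip).
apply: (@le_trans _ _ (nr z * c)); first by rewrite ler_wpM2l ?nr_ge0// lerDl.
by rewrite -ler_pdivlMr// ltW.
Unshelve. all: by end_near. Qed.

Definition spectral_mu x : {measure set borel -> \bar R} :=
  HB.pack (spectral_mass x) (isMeasure.Build _ _ _ (spectral_mass x)
    (@spectral_mass0 x) (@spectral_mass_ge0 x) (@spectral_mass_sigma x)).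

Lemma spectral_muE x D : measurable D -> spectral_mu x D = (nr (E D x) ^+ 2)%:E.
Proof. exact: spectral_massE. Qed.

Lemma pvm_bigcup0 x (F : nat -> set borel) : (forall n, measurable (F n)) ->
  (forall n, E (F n) x = 0) -> E (\bigcup_n F n) x = 0.
Proof.
move=> mF F0; have mU : measurable (\bigcup_n F n) by exact: bigcupT_measurable.
have := measure_sigma_subadditive (spectral_mu x) mF mU (@subset_refl _ _).
rewrite eseries0 => [|n _ _]; last by rewrite /= spectral_massE// F0 nr0 expr0n.
rewrite [leLHS]spectral_muE// lee_fin => h; apply: nr_eq0; apply/eqP.
by rewrite -sqrf_eq0 eq_le h sqr_ge0.
Qed.

End pvm.

(** * Spectral calculus through quadratic forms *)

Lemma self_adjointD (R : realType) (H : completeNormedModType R[i])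
    (ip : {dot H for Num.conj}) (A V : {linear H -> H}) :
  self_adjoint ip A -> self_adjoint ip V -> self_adjoint ip (A \+ V).
Proof. by move=> saA saV y z; rewrite /= linearDl linearDr /= saA saV. Qed.

Section spectral_calculus.
Variables (R : realType) (H : completeNormedModType R[i]).
Variable (ip : {dot H for Num.conj}).
Hypothesis hip : induces_norm ip.
Implicit Types (x y z : H).
Local Notation borel := (measurableTypeR R).
Import HBNNSimple.
Variables (E : set borel -> {linear H -> H}) (T : {linear H -> H}).
Hypothesis hT : spectral_measure ip T E.
Hypothesis saT : self_adjoint ip T.
Implicit Types (D : set borel).

Let hE : bounded_pvm ip E := proj1 hT.
Let mu x : {measure set borel -> \bar R} := spectral_mu hip hE x.

(** An integral only evaluates its measure on preimages of points under simple
  functions, which are Borel. *)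
Lemma integral_spectral_mu x (f : borel -> \bar R) :
  (\int[scalar_measure ip E x]_(t in setT) f t =
   \int[mu x]_(t in setT) f t)%E.
Proof.
have e (h : {nnsfun borel >-> R}) :
    sintegral (scalar_measure ip E x) h = sintegral (mu x) h.
  rewrite /sintegral; apply: eq_fsbigr => r _; congr (_ * _)%E.
  by rewrite [RHS]spectral_mass_scalar//; exact: measurable_funPTI.
rewrite /integral; congr (ereal_sup _ - ereal_sup _)%E;
  by apply/seteqP; split => _ [h hh <-]; exists h => //; rewrite e.
Qed.

Definition clamp (a b t : R) : R := Num.max a (Num.min b t).

Lemma measurable_clamp a b : measurable_fun setT (clamp a b : borel -> R).
Proof.
by apply: measurable_realfun.measurable_maxr => //; exact: measurable_realfun.measurable_minr.
Qed.

Lemma clamp_ge a b t : a <= clamp a b t.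
Proof. by rewrite /clamp le_max lexx. Qed.

Lemma clamp_le a b t : a <= b -> clamp a b t <= b.
Proof. by move=> ab; rewrite /clamp ge_max ab ge_min lexx. Qed.

Lemma mu_setT x : mu x setT = (nr x ^+ 2)%:E.
Proof. by rewrite [LHS]spectral_muE// (pvmT hE). Qed.

Lemma mu_fin x : (mu x setT < +oo)%E.
Proof. by rewrite mu_setT ltry. Qed.

Lemma clamp_integrable x a b : a <= b ->
  (mu x).-integrable setT (EFin \o (clamp a b : borel -> R)).
Proof.
move=> ab; apply: measurable_bounded_integrable => //.
- exact: mu_fin.
- exact: measurable_clamp.
- exists (`|a| + `|b|); split; first exact: num_real.
  move=> M hM t _ /=; apply: le_trans (ltW hM).
  have := clamp_ge a b t; have := clamp_le t ab.
  have := ler_norm a; have := ler_norm b.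
  have := ler_norm (- a); have := ler_norm (- b); rewrite !normrN.
  rewrite ler_norml => *; apply/andP; split; lra.
Qed.

(** A vector in the range of [E [a, b]] only sees the part of the spectral
  integral over [[a, b]], where the integrand may be truncated. *)
Lemma rip_clamp x a b : a <= b -> E `[a, b]%classic x = x ->
  (rip ip (T x) x)%:E = (\int[mu x]_(t in setT) (clamp a b t)%:E)%E.
Proof.
move=> ab Ex; have -> : rip ip (T x) x = fine (\int[mu x]_(t in setT) t%:E)%E.
  by rewrite /rip (proj2 hT x) integral_spectral_mu.
have -> : (\int[mu x]_(t in setT) t%:E = \int[mu x]_(t in setT) (clamp a b t)%:E)%E.
  apply: ae_eq_integral => //.
  - by apply/measurable_realfun.measurable_EFinP; exact: measurable_clamp.
  - exists (~` `[a, b]%classic); split.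
    + exact: measurableC.
    + by rewrite [LHS]spectral_muE ?(pvmC hE) ?Ex ?subrr ?nr0 ?expr0n//; exact: measurableC.
    + move=> t /= h; apply: contra_not h; rewrite in_itv /= => /andP[at_ tb] _.
      by rewrite /clamp min_r// max_r.
rewrite fineK//; apply: integrable_fin_num => //; exact: clamp_integrable.
Qed.

Lemma clamp_bounds x a b : a <= b -> E `[a, b]%classic x = x ->
  a * nr x ^+ 2 <= rip ip (T x) x <= b * nr x ^+ 2.
Proof.
move=> ab Ex; rewrite -!lee_fin (EFinM a) (EFinM b) -(mu_setT x).
rewrite -(integral_cst (mu x) measurableT a%:E) -(integral_cst (mu x) measurableT b%:E).
rewrite (rip_clamp ab Ex).
have ci c : (mu x).-integrable setT (cst c%:E).
  apply: (@measurable_bounded_integrable _ _ _ _ (cst c)) => //; first exact: mu_fin.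
  exists `|c|; split; [exact: num_real | by move=> M hM t _; exact: ltW].
apply/andP; split; apply: le_integral => //; try exact: clamp_integrable.
  by move=> t _; rewrite lee_fin clamp_ge.
by move=> t _; rewrite lee_fin clamp_le.
Qed.

(** The spectral masses of vectors in the ranges of two complementary spectral
  projections add up, hence so do the values of the form of [T]. *)
Lemma rip_split D x y : measurable D -> E D x = x -> E D y = 0 ->
  rip ip (T x) y = 0.
Proof.
move=> mD Dx Dy; have hD := pvm_proj hE mD.
have [M M0 hM] := pvm_supp hE.
have hM' z : E `[- M, M]%classic z = z.
  apply: (pvm_sub hE _ _ _ (hM z)) => // t /=; rewrite !in_itv /= => /andP[? ?].
  by apply/andP; split; exact: ltW.
have MM : - M <= M by lra.
have muD A : measurable A -> mu (x + y) A = measure_add (mu x) (mu y) A.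
  move=> mA; rewrite measure_addE 3?[in LHS]spectral_muE//.
  rewrite [in RHS]spectral_muE// [X in (_ = _ + X)%E]spectral_muE// -EFinD.
  rewrite linearD /= (nrD2 hip) -{2}Dx (pvm_comm hE)//.
  by rewrite (proj_rip _ _ hD) (pvm_comm hE)// Dy linear0 rip0r mulr0 addr0.
have := rip_clamp MM (hM' (x + y)).
rewrite (@eq_measure_integral _ _ _ _ (measure_add (mu x) (mu y))); last first.
  by move=> A mA _; exact: muD.
rewrite integral_measure_add//; try exact: clamp_integrable.
rewrite -(rip_clamp MM (hM' x)) -(rip_clamp MM (hM' y)) -EFinD => -[].
rewrite linearD /= !(ripDl, ripDr) (_ : rip ip (T y) x = rip ip (T x) y); first by lra.
by rewrite ripC /rip saT.
Qed.

(** Both [T u - E D (T u)], for [u] in the range of [E D], and [E D (T v)], for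
  [v] in its kernel, are orthogonal to themselves by [rip_split]. *)
Lemma pvm_commute D x : measurable D -> T (E D x) = E D (T x).
Proof.
move=> mD; have hD := pvm_proj hE mD.
have Eu z : E D (E D z) = E D z by exact: (pvm_idem hE).
have Eu0 z : E D (z - E D z) = 0 by rewrite linearB /= Eu subrr.
have in_range u : E D u = u -> E D (T u) = T u.
  move=> Du; apply/eqP; rewrite eq_sym -subr_eq0; apply/eqP/nr_eq0/eqP.
  rewrite -sqrf_eq0 -(ripxx hip) {1}ripBl (rip_split mD Du (Eu0 _)).
  by rewrite (proj_rip _ _ hD) Eu0 rip0r subrr.
have in_ker v : E D v = 0 -> E D (T v) = 0.
  move=> Dv; apply/nr_eq0/eqP; rewrite -sqrf_eq0 -(proj_nr2 hip _ hD).
  by rewrite /rip -saT -/(rip ip _ _) (rip_split mD (Eu _) Dv).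
rewrite -{2}(subrK (E D x) x) linearD /= [RHS]linearD /= in_ker// add0r.
by rewrite in_range.
Qed.

Lemma form_ge D x c : measurable D -> (forall t, D t -> c <= t) -> E D x = x ->
  c * nr x ^+ 2 <= rip ip (T x) x.
Proof.
move=> mD hD Dx; have [M M0 hM] := pvm_supp hE.
have cM : c <= Num.max c M by rewrite le_max lexx.
suff /(clamp_bounds cM)/andP[] : E `[c, Num.max c M]%classic x = x by [].
apply: (@pvm_sub _ _ _ _ hE (D `&` `]-M, M[%classic)) => //.
- exact: measurableI.
- move=> t [/= /hD ct]; rewrite !in_itv /= ct le_max => /andP[_ /ltW ->].
  by rewrite orbT.
- by rewrite -(pvmI hE)// hM.
Qed.

Lemma form_le D x c : measurable D -> (forall t, D t -> t <= c) -> E D x = x ->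
  rip ip (T x) x <= c * nr x ^+ 2.
Proof.
move=> mD hD Dx; have [M M0 hM] := pvm_supp hE.
have cM : Num.min c (- M) <= c by rewrite ge_min lexx.
suff /(clamp_bounds cM)/andP[] : E `[Num.min c (- M), c]%classic x = x by [].
apply: (@pvm_sub _ _ _ _ hE (D `&` `]-M, M[%classic)) => //.
- exact: measurableI.
- move=> t [/= /hD ct]; rewrite !in_itv /= ct ge_min => /andP[/ltW -> _].
  by rewrite orbT.
- by rewrite -(pvmI hE)// hM.
Qed.

(** Flipping the sign of the part of [x] where the spectrum is below [t] turns
  [T - t] into a positive operator without changing the norm of [x]. *)
Lemma gap_lower_bound D x t r : measurable D ->
  (forall s, D s -> r <= `|s - t|) -> E D x = x ->
  r * nr x <= nr (T x - t%:C%C *: x).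
Proof.
move=> mD hD Dx.
pose U := [set s : borel | t <= s].
have mU : measurable U.
  rewrite (_ : U = `[t, +oo[%classic); first exact: measurable_itv.
  by apply/seteqP; split => s /=; rewrite in_itv /= andbT.
have mDU := measurableI _ _ mD mU; have mDU' := measurableD mD mU.
pose p := E U x; pose m := x - p.
have Dp : E (D `&` U) p = p.
  by rewrite -(pvmI hE)// (pvm_idem hE)// /p (pvm_comm hE)// Dx.
have Um : E U m = 0 by rewrite /m linearB /= (pvm_idem hE)// subrr.
have Dm : E (D `\` U) m = m.
  rewrite setDE -(pvmI hE)//; last exact: measurableC.
  rewrite (pvmC hE)// Um subr0 /m linearB /= Dx /p.
  by rewrite (pvm_comm hE)// Dx.
have Up : E U p = p by rewrite /p (pvm_idem hE).
have Tpm : rip ip (T p) m = 0 by exact: rip_split Up Um.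
have pm : rip ip p m = 0 by rewrite -Up (proj_rip _ _ (pvm_proj hE mU)) Um rip0r.
have p_ge : (t + r) * nr p ^+ 2 <= rip ip (T p) p.
  apply: (form_ge mDU) Dp => s [/hD rs ts]; move: rs; rewrite ger0_norm ?subr_ge0//.
  lra.
have m_le : rip ip (T m) m <= (t - r) * nr m ^+ 2.
  apply: (form_le mDU') Dm => s [/hD rs /negP]; rewrite -ltNge => ts.
  by move: rs; rewrite ltr0_norm ?subr_lt0//; lra.
have xE : x = p + m by rewrite /m addrC subrK.
clearbody m p.
have nx : nr x ^+ 2 = nr p ^+ 2 + nr m ^+ 2 by rewrite xE (nrD2 hip) pm mulr0 addr0.
have nJ : nr (p - m) = nr x.
  apply/eqP; rewrite -(@eqrXn2 _ 2) ?nr_ge0// nx (nrB2 hip) pm.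
  by rewrite mulr0 subr0.
have Tmp : rip ip (T m) p = 0 by rewrite ripC /rip -saT -/(rip ip _ _).
have := cauchy_schwarz hip (T x - t%:C%C *: x) (p - m); rewrite nJ.
have -> : rip ip (T x - t%:C%C *: x) (p - m) =
    rip ip (T p) p - rip ip (T m) m - t * (nr p ^+ 2 - nr m ^+ 2).
  rewrite xE [T (p + m)]linearD /= ripBl ripZl !(ripDl, ripBr) Tpm Tmp pm (ripC _ m) pm.
  by rewrite !(ripxx hip); ring.
move=> h; have [->|x0] := eqVneq (nr x) 0; first by rewrite mulr0 nr_ge0.
have xp : 0 < nr x by rewrite lt_def x0 nr_ge0.
rewrite -(ler_pM2r xp); apply: le_trans h.
by rewrite -mulrA -expr2 nx; nra.
Qed.

(** Polarization at [a x + B x] and [a x - B x], with the optimal factor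
  [a = |B x| / |x|]. *)
Lemma symmetric_bound (B : {linear H -> H}) (N : set H) r : subspace N ->
  self_adjoint ip B -> (forall x, N x -> N (B x)) -> 0 <= r ->
  (forall x, N x -> `|rip ip (B x) x| <= r * nr x ^+ 2) ->
  forall x, N x -> nr (B x) <= r * nr x.
Proof.
move=> sN sB NB r0 hB x Nx; set y := B x.
have Ny : N y by exact: NB.
have [y0|y0] := eqVneq (nr y) 0; first by rewrite y0 mulr_ge0 ?nr_ge0.
have yp : 0 < nr y by rewrite lt_def y0 nr_ge0.
have key a : 2 * a * nr y ^+ 2 <= r * (a ^+ 2 * nr x ^+ 2 + nr y ^+ 2).
  pose u := a%:C%C *: x.
  have Nu : N u by exact: subspaceZ.
  have h1 := hB _ (subspaceD sN Nu Ny); have h2 := hB _ (subspaceB sN Nu Ny).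
  move: h1 h2; rewrite !ler_norml => /andP[_ h1] /andP[h2 _].
  move: h1 h2; rewrite linearD linearB /= !(ripDl, ripBl, ripDr, ripBr, ripNl, ripNr).
  rewrite (nrD2 hip) (nrB2 hip).
  have -> : rip ip (B y) u = a * nr y ^+ 2.
    by rewrite /rip sB -/(rip ip _ _) linearZ /= ripZr (ripxx hip).
  have -> : rip ip (B u) y = a * nr y ^+ 2.
    by rewrite linearZ /= ripZl (ripxx hip).
  have -> : nr u ^+ 2 = a ^+ 2 * nr x ^+ 2.
    by rewrite nrZr exprMn real_normK ?num_real.
  lra.
have [x0|x0] := eqVneq (nr x) 0.
  have := key (r + 1); rewrite x0 expr0n /= mulr0 add0r mulr0.
  have := exprn_gt0 2 yp; nra.
have xp : 0 < nr x by rewrite lt_def x0 nr_ge0.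
have := key (nr y / nr x); rewrite expr_div_n -mulrA.
rewrite divfK ?expf_neq0// => h.
have {}h : nr y / nr x * nr y ^+ 2 <= r * nr y ^+ 2 by lra.
by move: h; rewrite ler_pM2r ?exprn_gt0// ler_pdivrMr.
Qed.

(** On the range of [E D], which it preserves, the symmetric operator [T - t] has
  a form between [-r] and [r]. This bound and [gap_lower_bound] play the part of
  the functional calculus. *)
Lemma local_upper_bound D x t r : measurable D -> 0 <= r ->
  (forall s, D s -> `|s - t| <= r) -> E D x = x ->
  nr (T x - t%:C%C *: x) <= r * nr x.
Proof.
move=> mD r0 hD Dx.
have l : linear (fun z => T z - t%:C%C *: z).
  move=> a u v; rewrite linearP /= scalerDr scalerBr opprD addrACA.
  by rewrite !scalerA [_ * a]mulrC.
pose B : {linear H -> H} := HB.pack (fun z => T z - t%:C%C *: z)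
  (GRing.isLinear.Build _ _ _ _ _ l).
have sN : subspace [set z | E D z = z].
  by split; [rewrite /= linear0 | move=> a u v /= Du Dv; rewrite linearP /= Du Dv].
apply: (symmetric_bound (B := B) sN _ _ r0 _ Dx) => [u v|z /= Dz|z /= Dz].
- rewrite /= linearBl linearBr /= saT linearZl_LR linearZr_LR /=.
  by congr (_ - _ * _); rewrite [RHS]conjc_real.
- by rewrite linearB linearZ /= -pvm_commute// Dz.
- have le_ : rip ip (T z) z <= (t + r) * nr z ^+ 2.
    by apply: (form_le mD) Dz => s /hD; rewrite ler_norml => /andP[? ?]; lra.
  have ge_ : (t - r) * nr z ^+ 2 <= rip ip (T z) z.
    by apply: (form_ge mD) Dz => s /hD; rewrite ler_norml => /andP[? ?]; lra.
  by rewrite ripBl ripZl (ripxx hip) ler_norml; apply/andP; split; lra.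
Qed.

End spectral_calculus.

(** * Bounded operators and resolvents *)

Section bounded_operators.
Variables (R : realType) (H : completeNormedModType R[i]).
Implicit Types (x y z : H) (T V : {linear H -> H}).

Lemma norm_le1 x : (`|x| <= 1) = (nr x <= 1).
Proof. by rewrite normE -lecR. Qed.

Lemma continuous_bounded T : continuous T ->
  exists2 c : R, 0 < c & forall x, nr (T x) <= c * nr x.
Proof.
move=> /linear_bounded_continuous/linear_boundedP[M [Mr hM]].
have [m Mm] : exists m : R, M = m%:C%C by apply/complex_realP.
exists (`|m| + 1) => [|x]; first by rewrite ltr_wpDl.
have : `|T x| <= (`|m| + 1)%:C%C * `|x|.
  by apply: hM; rewrite Mm ltcR; have := ler_norm m; lra.
by rewrite !normE -rmorphM lecR.
Qed.

Lemma bounded_continuous T (c : R) :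
  (forall x, nr (T x) <= c * nr x) -> continuous T.
Proof.
move=> h; apply/linear_bounded_continuous/linear_boundedP.
exists (c%:C)%C; split; first by apply/complex_realP; exists c.
move=> M cM x; have [m Mm] : exists m : R, M = m%:C%C.
  by move: cM; rewrite ltcE => /andP[/eqP/= + _]; case: (M) => a b /= ->; exists a.
move: cM; rewrite Mm ltcR => cm; rewrite !normE -rmorphM lecR.
by rewrite (le_trans (h x))// ler_wpM2r ?nr_ge0// ltW.
Qed.

Lemma op_norm_bound V : continuous V ->
  0 <= op_norm V /\ forall x, nr (V x) <= op_norm V * nr x.
Proof.
move=> /continuous_bounded[c c0 hc].
have ub : has_ubound [set complex.Re `|V x| | x in [set x | `|x| <= 1]].
  exists c => _ [x /= + <-]; rewrite norm_le1 => x1; apply: le_trans (hc x) _.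
  by rewrite ler_piMr// ltW.
have h x : nr x <= 1 -> nr (V x) <= op_norm V.
  by move=> x1; apply: ub_le_sup => //; exists x; rewrite //= norm_le1.
have v0 : 0 <= op_norm V.
  by apply: le_trans (h 0 _); rewrite ?nr_ge0// nr0.
by split => // x; apply: linear_bounded_nr.
Qed.

(** A point is coloured by the first ball of a finite cover of the image that
  contains its image; the colour [size s] stands for no ball and only occurs
  outside the unit ball. *)
Lemma compact_operator_map V : compact_operator V -> compact_map V.
Proof.
move=> [U VU [cU _]] e e0; have e2 : (0 : R[i]) < (e / 2)%:C%C.
  by rewrite ltcR divr_gt0.
move: cU; rewrite compact_cover => /(_ H setT (fun y => ball y (e / 2)%:C%C)).
case=> [y _|x Ux|D _ hD].
- exact: ball_open.
- by exists x => //; exact: ballxx.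
pose s : seq H := finmap.enum_fset D.
pose k x : 'I_(size s).+1 := inord (find (fun y => `[< ball y (e / 2)%:C%C (V x) >]) s).
have near_center x : nr x <= 1 -> nr (V x - nth 0 s (k x)) <= e / 2.
  move=> x1; have Vx : U (V x) by apply: VU; exists x; rewrite //= norm_le1.
  have [y /= yD Vy] := hD _ Vx.
  have hs : has (fun y => `[< ball y (e / 2)%:C%C (V x) >]) s.
    by apply/hasP; exists y => //; apply/asboolP.
  rewrite inordK; last by rewrite ltnS find_size.
  have /asboolP := nth_find 0 hs.
  by rewrite -ball_normE /= normE ltcR nr_distC => /ltW.
exists 'I_(size s).+1, k => x y x1 y1 kxy.
have hx := near_center _ x1; have hy := near_center _ y1; rewrite -kxy in hy.
rewrite -(subrKA (nth 0 s (k x))) (le_trans (nrD _ _))// [leRHS](splitr e) lerD//.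
by rewrite nr_distC.
Qed.

End bounded_operators.

Section resolvent.
Variables (R : realType) (H : completeNormedModType R[i]).
Implicit Types (x y z : H) (T : {linear H -> H}).

Lemma resolvent_bounded_below T (t : R) : ~ spectrum T t%:C%C ->
  exists2 m : R, 0 < m & (forall x, m * nr x <= nr (T x - t%:C%C *: x)) /\
    forall y, exists x, T x - t%:C%C *: x = y.
Proof.
move=> /contrapT[S cS [ST TS]]; have [c c0 hc] := continuous_bounded cS.
exists c^-1; first by rewrite invr_gt0.
split => [x|y]; last by exists (S y); rewrite TS.
by rewrite mulrC ler_pdivrMr// mulrC -{1}(ST x) hc.
Qed.

Lemma bounded_below_resolvent T (t m : R) : 0 < m ->
  (forall x, m * nr x <= nr (T x - t%:C%C *: x)) ->
  (forall y, exists x, T x - t%:C%C *: x = y) -> ~ spectrum T t%:C%C.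
Proof.
move=> m0 hm surj; apply; have [S hS] := boolp.choice surj.
have inj x y : T x - t%:C%C *: x = T y - t%:C%C *: y -> x = y.
  move=> xy; apply/eqP; rewrite -subr_eq0; apply/eqP/nr_eq0/le_anti.
  rewrite nr_ge0 andbT -(ler_pM2l m0) mulr0 (le_trans (hm _))//.
  by rewrite [T _]linearB scalerBr opprD addrACA -opprD xy subrr nr0.
have lS : linear S.
  move=> a x y; apply: inj; rewrite hS linearP /= scalerDr opprD addrACA hS.
  by congr (_ + _); rewrite scalerA mulrC -scalerA -scalerBr hS.
pose S' : {linear H -> H} := HB.pack S (GRing.isLinear.Build _ _ _ _ S lS).
exists S'; first last.
  by split => x; [apply: inj; rewrite hS|exact: hS].
apply: (@bounded_continuous _ _ S' m^-1) => x /=.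
by rewrite mulrC ler_pdivlMr// mulrC (le_trans (hm _))// hS.
Qed.

Lemma neumann_scale T (q c : R) : 0 <= q -> q < 1 ->
  (forall x, nr (c%:C%C *: T x) <= q * nr x) ->
  forall y, exists x, x + c%:C%C *: T x = y.
Proof.
move=> q0 q1 hq; have l : linear (fun x => c%:C%C *: T x).
  by move=> a x y; rewrite linearP /= scalerDr !scalerA mulrC.
pose G : {linear H -> H} := HB.pack (fun x => c%:C%C *: T x)
  (GRing.isLinear.Build _ _ _ _ _ l).
exact: (@neumann_surj _ _ G q).
Qed.

(** With [S] the inverse of [T - t], solving [(T - s) x = y] amounts to solving
  [x - (s - t) S x = S y], a Neumann series for [s] close to [t]. *)
Lemma resolvent_open T (t : R) : ~ spectrum T t%:C%C ->
  exists2 r : R, 0 < r & forall s, `|s - t| < r -> ~ spectrum T s%:C%C.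
Proof.
move=> ns; have [S cS [ST TS]] := contrapT ns.
have [m m0 [hm _]] := resolvent_bounded_below ns.
have [c c0 hc] := continuous_bounded cS.
(* [m / 2] preserves a lower bound, [c^-1 / 2] gives the series the ratio 1/2 *)
exists (Num.min (m / 2) (c^-1 / 2)) => [|s].
  by rewrite lt_min !divr_gt0// invr_gt0.
rewrite lt_min => /andP[st_m st_c].
have E x : T x - s%:C%C *: x = (T x - t%:C%C *: x) - (s - t)%:C%C *: x.
  by rewrite rmorphB scalerBl opprB addrA subrK.
apply: (@bounded_below_resolvent _ _ (m / 2)); first by rewrite divr_gt0.
  move=> x; rewrite E.
  have := nrB (T x - t%:C%C *: x - (s - t)%:C%C *: x) (- ((s - t)%:C%C *: x)).
  rewrite opprK subrK nrN nrZr => h; have := hm x; have := nr_ge0 x; nra.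
move=> y.
have q0 : (0 : R) <= 1 / 2 by lra.
have q1 : (1 / 2 : R) < 1 by lra.
have [|x xE] := @neumann_scale S (1 / 2) (- (s - t)) q0 q1 _ (S y).
  move=> x; rewrite nrZr normrN; have := hc x; have := nr_ge0 x; have := nr_ge0 (S x).
  move=> h1 h2 h3; apply: (@le_trans _ _ (`|s - t| * (c * nr x))).
    by rewrite ler_wpM2l.
  rewrite mulrA ler_wpM2r//; move: st_c; rewrite -(ltr_pM2r c0) mulrAC mulVf ?gt_eqF//.
  by move/ltW.
exists x; rewrite E -[RHS](TS y) -xE [T (x + _)]linearD [T (_ *: _)]linearZ /=.
rewrite scalerDr [- (_ *: x + _)]opprD addrACA.
congr (_ + _); rewrite scalerA [t%:C%C * _]mulrC -scalerA -scalerBr TS.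
by rewrite rmorphN scaleNr.
Qed.

End resolvent.

(** * The spectral measure and the spectrum *)

Section spectrum.
Variables (R : realType) (H : completeNormedModType R[i]).
Implicit Types (x y z : H) (T : {linear H -> H}).
Local Notation borel := (measurableTypeR R).

Lemma closed_borel (D : set borel) : closed (D : set R) -> measurable D.
Proof. exact: measurable_realfun.closed_measurable. Qed.

Lemma open_borel (D : set borel) : open (D : set R) -> measurable D.
Proof. exact: measurable_realfun.open_measurable. Qed.

Lemma open_set_nbhd (e : R) (D : set R) : open (set_nbhd e D).
Proof.
rewrite openE => t [s Ds ts]; exists (e - `|t - s|) => [|u] /=; first by rewrite subr_gt0.
move=> ut; exists s => //; have := ler_distD t u s; rewrite (distrC u t).
by move: ut; rewrite /ball /=; lra.
Qed.

Lemma spectrum_real T (S : set R) (t : R) :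
  spectrum T = [set (u%:C)%C | u in S] -> ~ S t -> ~ spectrum T t%:C%C.
Proof. by move=> -> nt [u Su] [ut]; apply: nt; rewrite -ut. Qed.

Lemma spectrum_closed T (S : set R) :
  spectrum T = [set (u%:C)%C | u in S] -> closed S.
Proof.
move=> spT; rewrite -[S]setCK; apply/open_closedC; rewrite openE => t /= nt.
have [r r0 hr] := resolvent_open (spectrum_real spT nt).
exists r => //= s ts Ss; apply: (hr s); first by rewrite distrC.
by rewrite spT; exists s.
Qed.

Lemma spectrum_bounded T (S : set R) : continuous T ->
  spectrum T = [set (u%:C)%C | u in S] ->
  exists2 M : R, 0 < M & forall t, S t -> `|t| <= M.
Proof.
move=> /continuous_bounded[c c0 hc] spT; exists c => // t St.
rewrite leNgt; apply/negP => ct.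
have t0 : 0 < `|t| by exact: lt_trans ct.
have tn0 : t != 0 by rewrite -normr_gt0.
have : spectrum T t%:C%C by rewrite spT; exists t.
apply: (@bounded_below_resolvent _ _ _ _ (`|t| - c)); first by rewrite subr_gt0.
  move=> x; have := nrB (T x - t%:C%C *: x) (T x).
  by rewrite addrAC subrr add0r nrN nrZr; have := hc x; nra.
move=> y.
have q0 : 0 <= c / `|t| by rewrite divr_ge0// ltW.
have q1 : c / `|t| < 1 by rewrite ltr_pdivrMr// mul1r.
have [|x xE] := @neumann_scale _ _ T _ (- t^-1) q0 q1 _ ((- t^-1)%:C%C *: y).
  move=> x; rewrite nrZr normrN normfV [c / _]mulrC -mulrA.
  by rewrite ler_wpM2l ?invr_ge0.
exists x; have := congr1 (fun z => (- t)%:C%C *: z) xE.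
rewrite scalerDr !scalerA -!rmorphM /= mulrNN divff//.
by rewrite !scale1r rmorphN scaleNr addrC.
Qed.

Section null_sets.
Variable (ip : {dot H for Num.conj}).
Hypothesis hip : induces_norm ip.
Variable (E : set borel -> {linear H -> H}).
Hypothesis hE : bounded_pvm ip E.
Implicit Types (D : set borel).

(** The null intervals with rational centre and inverse integer radius are
  countably many and cover [D]. *)
Lemma pvm_locally_null D : measurable D ->
  (forall t, D t -> exists2 r : R, 0 < r & forall x, E `]t - r, t + r[%classic x = 0) ->
  forall x, E D x = 0.
Proof.
move=> mD hD x.
pose I (p : rat * nat) : set borel :=
  `]ratr p.1 - p.2.+1%:R^-1, ratr p.1 + p.2.+1%:R^-1[%classic.
pose F n : set borel := if unpickle n is Some p then
  (if `[< forall x, E (I p) x = 0 >] then I p else set0) else set0.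
have mF n : measurable (F n).
  by rewrite /F; case: unpickle => // p; case: asboolP => // _; exact: measurable_itv.
have F0 n y : E (F n) y = 0.
  rewrite /F; case: unpickle => [p|]; last exact: pvm_set0 hE _.
  by case: asboolP => // _; exact: pvm_set0 hE _.
have mU : measurable (\bigcup_n F n) by exact: bigcupT_measurable.
apply: (pvm_sub0 hE mD mU); last exact: pvm_bigcup0.
move=> t /hD[r r0 hr].
pose k := Num.trunc (2 / r).
have kr : k.+1%:R^-1 < r / 2.
  rewrite -[r / 2]invrK invf_div ltf_pV2 ?posrE ?divr_gt0//.
  by have := truncnS_gt (2 / r).
have k0 : (0 : R) < k.+1%:R^-1 by rewrite invr_gt0.
have [q /andP[q1 q2]] : exists q : rat, t < ratr q < t + k.+1%:R^-1.
  have [|q] := @rat_in_itvoo R t (t + k.+1%:R^-1); first by rewrite ltrDl.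
  by rewrite in_itv /= => hq; exists q.
suff tF : F (pickle (q, k)) t by exists (pickle (q, k)); [exact: Logic.I|exact: tF].
rewrite /F pickleK asboolT => [|y].
  have t1 : ratr q - k.+1%:R^-1 < t by rewrite ltrBlDr.
  have t2 : t < ratr q + k.+1%:R^-1 by rewrite (lt_trans q1)// ltrDl.
  by rewrite /I /= in_itv /= t1 t2.
apply: (pvm_sub0 hE _ _ _ (hr y)); [exact: measurable_itv|exact: measurable_itv|].
have key (e u v : R) : e < r / 2 -> t < u -> u < t + e -> u - e < v -> v < u + e ->
    t - r < v < t + r.
  by move=> *; apply/andP; split; lra.
by move=> s; rewrite /I /= !in_itv /= => /andP[]; exact: key.
Qed.

End null_sets.

Section spectral_null.
Variable (ip : {dot H for Num.conj}).
Hypothesis hip : induces_norm ip.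
Variables (E : set borel -> {linear H -> H}) (T : {linear H -> H}).
Hypothesis hT : spectral_measure ip T E.
Hypothesis saT : self_adjoint ip T.
Let hE : bounded_pvm ip E := proj1 hT.

(** On the range of [E] of the interval of radius [m / 2], the operator [T - t]
  has norm at most [m / 2] while being bounded below by [m]. *)
Lemma bounded_below_null (t m : R) : 0 < m ->
  (forall x, m * nr x <= nr (T x - t%:C%C *: x)) ->
  exists2 r : R, 0 < r & forall x, E `]t - r, t + r[%classic x = 0.
Proof.
move=> m0 hm; exists (m / 2) => [|x]; first by rewrite divr_gt0.
set D : set borel := (X in E X).
have mD : measurable D by exact: measurable_itv.
have m2 : 0 <= m / 2 by lra.
have := local_upper_bound (t := t) hip hT saT mD m2 _ (pvm_idem hE x mD).
move=> /(_ _)/(le_trans (hm _)) h; apply: nr_eq0.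
have {}h : m * nr (E D x) <= m / 2 * nr (E D x).
  apply: h => s; rewrite /D /= in_itv /= => /andP[? ?].
  by rewrite ler_norml; apply/andP; split; lra.
have := nr_ge0 (E D x); nra.
Qed.

Lemma pvm_spectrum (S : set R) : spectrum T = [set (u%:C)%C | u in S] ->
  forall x, E S x = x.
Proof.
move=> spT x; have mS : measurable (S : set borel).
  exact: closed_borel (spectrum_closed spT).
have h y : E (~` S) y = 0.
  apply: (pvm_locally_null hip hE) => [|t nt]; first exact: measurableC.
  have [m m0 [hm _]] := resolvent_bounded_below (spectrum_real spT nt).
  exact: bounded_below_null m0 hm.
by have := h x; rewrite (pvmC hE)// => /eqP; rewrite subr_eq0 => /eqP.
Qed.

End spectral_null.

(** At a point [t] at distance at least [r] from [S], the operator [A - t] is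
  bounded below by [r], hence [A + V - t] by [r - op_norm V], and [t] has a null
  neighbourhood. *)
Lemma pvm_nbhd_spectrum (ip : {dot H for Num.conj}) (A V : {linear H -> H})
    (EA EB : set borel -> {linear H -> H}) (S : set R) (r : R) :
  induces_norm ip -> self_adjoint ip A -> self_adjoint ip V -> continuous V ->
  spectral_measure ip A EA -> spectral_measure ip (A \+ V) EB ->
  spectrum A = [set (u%:C)%C | u in S] -> op_norm V < r ->
  forall x, EB (set_nbhd r S) x = x.
Proof.
move=> hip saA saV cV hA hB spA Vr x.
have [v0 hV] := op_norm_bound cV.
have saB := self_adjointD saA saV.
have mS : measurable (S : set borel) by exact: closed_borel (spectrum_closed spA).
have mN : measurable (set_nbhd r S : set borel) by apply: open_borel; exact: open_set_nbhd.
suff h y : EB (~` set_nbhd r S) y = 0.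
  by have := h x; rewrite (pvmC (proj1 hB))// => /eqP; rewrite subr_eq0 => /eqP.
apply: (pvm_locally_null hip (proj1 hB)) => [|t nt]; first exact: measurableC.
apply: (bounded_below_null hip hB saB (m := r - op_norm V)); first by rewrite subr_gt0.
move=> z; have far s : S s -> r <= `|s - t|.
  by move=> Ss; rewrite leNgt; apply/negP => st; apply: nt; exists s; rewrite // distrC.
have := gap_lower_bound hip hA saA mS far (pvm_spectrum hip hA saA spA z).
have h2 := nrB (A z + V z - t%:C%C *: z) (V z).
rewrite addrAC addrK [A z + _ - _]addrAC in h2; have := hV z => h3 h1.
have -> : (A \+ V) z - t%:C%C *: z = A z - t%:C%C *: z + V z by rewrite addrAC.
by lra.
Qed.

End spectrum.

(** * A Sylvester equation *)

Section sylvester.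
Variables (R : realType) (H : completeNormedModType R[i]).
Variable (ip : {dot H for Num.conj}).
Hypothesis hip : induces_norm ip.
Implicit Types (x y z : H).
Local Notation borel := (measurableTypeR R).
Variables (A V : {linear H -> H}) (EA EB : set borel -> {linear H -> H}).
Hypothesis saA : self_adjoint ip A.
Hypothesis saV : self_adjoint ip V.
Hypothesis hA : spectral_measure ip A EA.
Hypothesis hB : spectral_measure ip (A \+ V) EB.
Hypothesis cV : compact_map V.

(** [X = EB D2 EA D1] solves [(B - t) X = X (A - t) + EB D2 V EA D1], where
  [B = A + V]. The last term is compact, and the two resolvent-type bounds turn
  a [rho]-colouring of [X] into one at scale [(r * rho + eta) / r']; the scales
  decrease geometrically because [r < r']. *)
Lemma compact_separated (D1 D2 : set borel) (t r r' : R) :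
  measurable D1 -> measurable D2 -> 0 < r -> r < r' ->
  (forall s, D1 s -> `|s - t| <= r) -> (forall s, D2 s -> r' <= `|s - t|) ->
  compact_map (EB D2 \o EA D1).
Proof.
move=> mD1 mD2 r0 rr' hD1 hD2.
have saB := self_adjointD saA saV.
have hEA := proj1 hA; have hEB := proj1 hB.
have hp1 := pvm_proj hEA mD1; have hp2 := pvm_proj hEB mD2.
pose p := EA D1; pose q := EB D2; pose X x := q (p x).
have pp z : p (p z) = p z by exact: (pvm_idem hEA z mD1).
have qq z : q (q z) = q z by exact: (pvm_idem hEB z mD2).
have XB u v : X (u - v) = X u - X v by rewrite /X !linearB.
pose Y x := q (V (p x)).
have cY : compact_map Y.
  apply: (@compact_map_compl _ _ q (V \o p) 1) => [x|].
    by rewrite mul1r (proj_nr hip).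
  by apply: compact_map_compr cV => x; rewrite (proj_nr hip).
pose W x := A (p x) - t%:C%C *: p x.
have WB u v : W (u - v) = W u - W v.
  by rewrite /W [p _]linearB [A _]linearB scalerBr opprD addrACA -opprD.
have pW x : p (W x) = W x.
  by rewrite /W linearB linearZ /= -(pvm_commute hip hA saA)// pp.
have nW x : nr (W x) <= r * nr x.
  apply: le_trans (local_upper_bound hip hA saA mD1 (ltW r0) hD1 (pp x)) _.
  by rewrite ler_wpM2l ?(proj_nr hip)// ltW.
have nX x : nr (X x) <= nr x.
  by rewrite (le_trans (proj_nr hip _ hp2))// (proj_nr hip).
have eqX x : A (X x) + V (X x) - t%:C%C *: X x = X (W x) + Y x.
  have := pvm_commute hip hB saB (p x) mD2 => /= ->.
  rewrite linearD /= -/q /Y addrAC; congr (_ + _).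
  by rewrite /X pW /W [RHS]linearB [X in _ = _ - X]linearZ.
have lowX x : r' * nr (X x) <= nr (X (W x) + Y x).
  rewrite -eqX; exact: (gap_lower_bound hip hB saB mD2 hD2 (qq (p x))).
have r'0 : 0 < r' by exact: lt_trans rr'.
pose colourable rho := exists (F : finType) (k : H -> F), forall x y,
  nr x <= 1 -> nr y <= 1 -> k x = k y -> nr (X x - X y) <= rho.
have col_le a b : a <= b -> colourable a -> colourable b.
  move=> ab [F [k hk]]; exists F, k => x y x1 y1 kxy.
  by apply: le_trans ab; exact: hk.
have col2 : colourable 2.
  exists unit, (fun=> tt) => x y x1 y1 _; rewrite (le_trans (nrB _ _))//.
  by rewrite -[2]/(1 + 1) lerD// (le_trans (nX _)).
have step rho eta : 0 < eta -> colourable rho -> colourable ((r * rho + eta) / r').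
  move=> eta0 [F [k hk]]; have [G [l hl]] := cY eta eta0.
  pose Wr x := r^-1%:C%C *: W x.
  have nWr x : nr x <= 1 -> nr (Wr x) <= 1.
    move=> x1; rewrite nrZr gtr0_norm ?invr_gt0// mulrC ler_pdivrMr// mul1r.
    by rewrite (le_trans (nW x))// ler_piMr// ltW.
  exists (F * G)%type, (fun x => (k (Wr x), l x)) => x y x1 y1 [kxy lxy].
  rewrite -XB ler_pdivlMr// mulrC (le_trans (lowX _))//.
  have -> : W (x - y) = r%:C%C *: (Wr x - Wr y).
    by rewrite WB -scalerBr scalerA -rmorphM /= divff ?gt_eqF// scale1r.
  rewrite (le_trans (nrD _ _))// lerD//.
    rewrite /X linearZ /= linearZ /= nrZr gtr0_norm// ler_wpM2l ?(ltW r0)//.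
    by rewrite -/(X _) XB hk// nWr.
  by rewrite /Y !linearB; exact: hl.
move=> e e0; change (colourable e).
pose c := r / r'.
have c0 : 0 <= c by rewrite divr_ge0// ltW.
have c1 : c < 1 by rewrite ltr_pdivrMr// mul1r.
have iter n : colourable (c ^+ n * 2 + e / 2).
  elim: n => [|n IH].
    by apply: col_le col2; rewrite expr0 mul1r lerDl divr_ge0// ltW.
  (* this [eta] makes [e / 2] the fixed point of the recursion on scales *)
  have eta0 : 0 < (r' - r) * (e / 2) by rewrite mulr_gt0 ?subr_gt0// divr_gt0.
  apply: col_le (step _ _ eta0 IH).
  rewrite exprS {1 2 3}/c le_eqVlt; apply/orP; left; apply/eqP.
  by field; rewrite gt_eqF.
have : (fun n => c ^+ n * 2) @ \oo --> (0 : R).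
  rewrite -[X in _ --> X](mul0r 2); apply: cvgMl.
  by apply: cvg_expr; rewrite ger0_norm.
move=> /cvgrPdist_lt /(_ (e / 2)) []; first by rewrite divr_gt0.
move=> n _ /(_ n (leqnn _)); rewrite sub0r normrN => h.
apply: col_le (iter n); have := ler_norm (c ^+ n * 2); lra.
Qed.

End sylvester.

(** * Spectral projections of half-lines *)

Section half_lines.
Variables (R : realType) (H : completeNormedModType R[i]).
Variable (ip : {dot H for Num.conj}).
Hypothesis hip : induces_norm ip.
Implicit Types (x y z : H).
Local Notation borel := (measurableTypeR R).
Variables (A V : {linear H -> H}) (EA EB : set borel -> {linear H -> H}).
Hypothesis saA : self_adjoint ip A.
Hypothesis saV : self_adjoint ip V.
Hypothesis hA : spectral_measure ip A EA.
Hypothesis hB : spectral_measure ip (A \+ V) EB.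
Variable S : set R.
Hypothesis spA : spectrum A = [set (u%:C)%C | u in S].
Variable g : R.
Hypothesis g0 : 0 < g.

Let saB : self_adjoint ip (A \+ V) := self_adjointD saA saV.
Let mS : measurable (S : set borel) := closed_borel (spectrum_closed spA).
Let hEA : bounded_pvm ip EA := proj1 hA.
Let hEB : bounded_pvm ip EB := proj1 hB.

Definition below (c : R) : set borel := `]-oo, c[%classic.

Lemma measurable_below c : measurable (below c).
Proof. exact: measurable_itv. Qed.

(** Cuts are the midpoints of spectral gaps of [A] of length at least [2 * g]. *)
Definition cut c := forall s, S s -> g <= `|s - c|.

Lemma cut_below c s : cut c -> S s -> s < c -> s <= c - g.
Proof. by move=> hc /hc h sc; move: h; rewrite ltr0_norm ?subr_lt0//; lra. Qed.

Lemma cut_above c s : cut c -> S s -> c <= s -> c + g <= s.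
Proof. by move=> hc /hc h sc; move: h; rewrite ger0_norm ?subr_ge0//; lra. Qed.

Lemma EA_spectrum D x : measurable D -> EA (D `&` S) x = EA D x.
Proof.
by move=> mD; rewrite -(pvmI hEA)// (pvm_spectrum hip hA saA spA).
Qed.

Lemma notbelow c s : (~` below c) s -> c <= s.
Proof. by rewrite /below /= in_itv /= => /negP; rewrite -leNgt. Qed.

Lemma measurable_above c : measurable (~` below c).
Proof. by apply: measurableC; exact: measurable_below. Qed.

Section forms.
Hypothesis hV : exists2 v, v < g & forall x, nr (V x) <= v * nr x.

Lemma form_contradiction x : g * nr x ^+ 2 <= `|rip ip (V x) x| -> x = 0.
Proof.
have [v vg vV] := hV; rewrite -normrN => h; apply: nr_eq0; apply/eqP.
have h1 : `|rip ip (V x) x| <= v * nr x ^+ 2.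
  apply: (@le_trans _ _ (nr (V x) * nr x)).
    by rewrite ler_norml (ripN_le hip)// (cauchy_schwarz hip).
  by rewrite expr2 mulrA ler_wpM2r ?nr_ge0.
rewrite normrN in h; rewrite -sqrf_eq0 eq_le sqr_ge0 andbT.
have := le_trans h h1; have := sqr_ge0 (nr x); nra.
Qed.

(** On a common vector of the two spectral subspaces the forms of [A] and
  [A + V] would differ by at least [g]. *)
Lemma half_line_defect1 c x : cut c ->
  defect (EA (below c)) (EB (below c)) x -> x = 0.
Proof.
move=> hc [Ax Bx]; apply: form_contradiction.
have a_le : rip ip (A x) x <= (c - g) * nr x ^+ 2.
  apply: (form_le hip hA (D := below c `&` S)).
  - exact: measurableI (measurable_below c) mS.
  - by move=> t [+ St]; rewrite /below /= in_itv /= => tc; exact: cut_below.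
  - by rewrite (EA_spectrum _ (measurable_below c)).
have b_ge : c * nr x ^+ 2 <= rip ip ((A \+ V) x) x.
  apply: (form_ge hip hB (D := ~` below c)); first exact: measurable_above.
    by move=> t /notbelow.
  by rewrite (pvmC hEB _ (measurable_below c)) Bx subr0.
move: b_ge; rewrite /= ripDl => b_ge; have := ler_norm (rip ip (V x) x); lra.
Qed.

Lemma half_line_defect2 c x : cut c ->
  defect (EB (below c)) (EA (below c)) x -> x = 0.
Proof.
move=> hc [Bx Ax]; apply: form_contradiction.
have a_ge : (c + g) * nr x ^+ 2 <= rip ip (A x) x.
  apply: (form_ge hip hA (D := ~` below c `&` S)).
  - exact: measurableI (measurable_above c) mS.
  - by move=> t [/notbelow ct St]; exact: cut_above.
  - rewrite (EA_spectrum _ (measurable_above c)).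
    by rewrite (pvmC hEA _ (measurable_below c)) Ax subr0.
have b_le : rip ip ((A \+ V) x) x <= c * nr x ^+ 2.
  apply: (form_le hip hB (D := below c)) => //; first exact: measurable_below.
  by move=> t; rewrite /below /= in_itv /= => /ltW.
move: b_le; rewrite /= ripDl => b_le; have := ler_norm (- rip ip (V x) x).
rewrite normrN; lra.
Qed.

Lemma half_line_indexC c : cut c ->
  index_zero ip (EA (~` below c)) (EB (~` below c)).
Proof.
have E0 (F : set borel -> {linear H -> H}) x : bounded_pvm ip F ->
    F (~` below c) x = x -> F (below c) x = 0.
  move=> hF <-; have m := measurable_below c.
  by rewrite (pvmC hF _ m) linearB /= (pvm_idem hF _ m) subrr.
have E1 (F : set borel -> {linear H -> H}) x : bounded_pvm ip F ->
    F (~` below c) x = 0 -> F (below c) x = x.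
  by move=> hF; rewrite (pvmC hF _ (measurable_below c)) => /eqP; rewrite subr_eq0 => /eqP.
move=> hc; apply: index_zero_defect0 => x [e f].
  by apply: (half_line_defect2 hc); split; [exact: E1 f|exact: E0 e].
by apply: (half_line_defect1 hc); split; [exact: E1 f|exact: E0 e].
Qed.

End forms.

(** [P - Q = (1 - Q) P - Q (1 - P)], and each term falls under
  [compact_separated]. The disc there has diameter [[-N, c - g]] for the first
  and [[c + g, N]] for the second: it contains the spectrum of [A] on one side of
  [c] and lies at distance [g] from the half-line on the other side. *)
Lemma half_line_compact c : compact_map V -> cut c ->
  compact_map (fun x => EA (below c) x - EB (below c) x).
Proof.
move=> cV hc; have [M M0 hM] := pvm_supp hEA.
pose N := Num.max M (`|c| + g + 1).
have NM : M <= N by rewrite le_max lexx.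
have Nc : `|c| + g + 1 <= N by rewrite le_max lexx orbT.
have hN x : EA `]-N, N[%classic x = x.
  apply: (pvm_sub hEA _ _ _ (hM x)) => // t /=; rewrite !in_itv /= => /andP[? ?].
  by apply/andP; split; lra.
have cn := ler_norm c; have cn' := ler_norm (- c); rewrite normrN in cn'.
pose D1 : set borel := (below c `&` S) `&` `]-N, N[%classic.
pose D2 : set borel := (~` below c `&` S) `&` `]-N, N[%classic.
have gp := g0; have mb := measurable_below c; have ma := measurable_above c.
have mN : measurable (`]-N, N[%classic : set borel) by exact: measurable_itv.
have mbS : measurable (below c `&` S) by exact: measurableI.
have maS : measurable (~` below c `&` S) by exact: measurableI.
have mD1 : measurable D1 by exact: measurableI.
have mD2 : measurable D2 by exact: measurableI.
have D1E x : EA D1 x = EA (below c) x by rewrite -(pvmI hEA _ mbS mN) hN EA_spectrum.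
have D2E x : EA D2 x = x - EA (below c) x.
  by rewrite -(pvmI hEA _ maS mN) hN EA_spectrum// (pvmC hEA).
have c1 : compact_map (EB (~` below c) \o EA D1).
  apply: (compact_separated hip saA saV hA hB cV (t := (c - g - N) / 2)
    (r := (c - g + N) / 2) (r' := (c - g + N) / 2 + g) mD1 ma).
  - lra.
  - by rewrite ltrDl.
  - move=> s [[+ Ss]]; rewrite /below /= in_itv /= => sc; have := cut_below hc Ss sc.
    rewrite /= in_itv /= => h /andP[h1 _]; move: (s : R) h h1 => u h h1.
    by rewrite ler_norml; apply/andP; split; lra.
  - by move=> s /notbelow; move: (s : R) => u cu; rewrite ger0_norm; lra.
have c2 : compact_map (EB (below c) \o EA D2).
  apply: (compact_separated hip saA saV hA hB cV (t := (c + g + N) / 2)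
    (r := (N - c - g) / 2) (r' := (N - c - g) / 2 + g) mD2 mb).
  - lra.
  - by rewrite ltrDl.
  - move=> s [[/notbelow cs Ss]]; have := cut_above hc Ss cs.
    rewrite /= in_itv /= => h /andP[_ h1]; move: (s : R) h h1 => u h h1.
    by rewrite ler_norml; apply/andP; split; lra.
  - by move=> s; rewrite /below /= in_itv /=; move: (s : R) => u uc; rewrite ltr0_norm; lra.
apply: eq_compact_map (compact_mapB c1 c2) => x /=.
by rewrite (pvmC hEB)// D1E D2E linearB /= opprB addrA subrK.
Qed.

End half_lines.

(** * Clusters of the spectrum *)

Section clusters.
Variables (R : realType) (H : completeNormedModType R[i]).
Variable (ip : {dot H for Num.conj}).
Hypothesis hip : induces_norm ip.
Implicit Types (x y z : H).
Local Notation borel := (measurableTypeR R).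
Variables (A V : {linear H -> H}) (EA EB : set borel -> {linear H -> H}).
Hypothesis saA : self_adjoint ip A.
Hypothesis saV : self_adjoint ip V.
Hypothesis hA : spectral_measure ip A EA.
Hypothesis hB : spectral_measure ip (A \+ V) EB.
Variable S : set R.
Hypothesis spA : spectrum A = [set (u%:C)%C | u in S].
Variable g : R.
Hypothesis g0 : 0 < g.
Hypothesis contV : continuous V.
Hypothesis normV : op_norm V < g.
Hypothesis cV : compact_map V.

Let hEA : bounded_pvm ip EA := proj1 hA.
Let hEB : bounded_pvm ip EB := proj1 hB.

(** Index zero for the part [T] of the spectrum. Compactness is included because
  additivity of the index depends on it. *)
Definition balanced (T : set borel) : Prop :=
  compact_map (fun x => EA T x - EB (set_nbhd g T) x) /\
  index_zero ip (EA T) (EB (set_nbhd g T)).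

Definition separated (T1 T2 : set R) : Prop :=
  forall s t, T1 s -> T2 t -> g + g <= `|s - t|.

Lemma separatedC T1 T2 : separated T1 T2 -> separated T2 T1.
Proof. by move=> h s t T2s T1t; rewrite distrC; exact: h. Qed.

Lemma balanced0 : balanced set0.
Proof.
rewrite /balanced; have -> : set_nbhd g set0 = set0 :> set R.
  by apply/seteqP; split => t // [].
split.
  apply: eq_compact_map (compact_map0 H) => x.
  by rewrite (pvm_set0 hEA) (pvm_set0 hEB) subrr.
apply: index_zero_defect0 => x []; first by rewrite (pvm_set0 hEA).
by rewrite (pvm_set0 hEB).
Qed.

Definition blocks (T : Type) (a b c : T) (j : 'I_3) : T :=
  match nat_of_ord j with 0%N => a | 1%N => b | _ => c end.

Lemma blocks_disjoint (a b c : set borel) : a `&` b = set0 -> a `&` c = set0 ->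
  b `&` c = set0 -> forall i j, i != j -> blocks a b c i `&` blocks a b c j = set0.
Proof.
move=> ab ac bc [[|[|[|//]]] hi] [[|[|[|//]]] hj] //= _;
  by rewrite /blocks /= // setIC.
Qed.

Lemma blocks_all (T : Type) (p : T -> Prop) (a b c : T) : p a -> p b -> p c ->
  forall j, p (blocks a b c j).
Proof. by move=> pa pb pc [[|[|[|//]]] hj]. Qed.

(** Below a cut the pair is balanced by the half-line, as is its complement
  above the cut; index additivity then passes from one part to the other. *)
Lemma balanced_complement c (T1 T2 : set borel) : cut S g c ->
  measurable T1 -> measurable T2 -> separated T1 T2 ->
  T1 `|` T2 = S `&` below c -> balanced T2 -> balanced T1.
Proof.
move=> hc mT1 mT2 sep T12 [c2 i2].
have gp := g0.
have hV : exists2 v, v < g & forall x, nr (V x) <= v * nr x.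
  by exists (op_norm V) => //; case: (op_norm_bound contV).
pose N1 : set borel := set_nbhd g T1; pose N2 : set borel := set_nbhd g T2.
have mN1 : measurable N1 by apply: open_borel; exact: open_set_nbhd.
have mN2 : measurable N2 by apply: open_borel; exact: open_set_nbhd.
have mN : measurable (set_nbhd g S : set borel).
  by apply: open_borel; exact: open_set_nbhd.
have mb := @measurable_below R c; have ma := @measurable_above R c.
have T1S s : T1 s -> S s /\ s < c.
  move=> Ts; have : (T1 `|` T2) s by left.
  by rewrite T12 /below /= in_itv.
have T2S s : T2 s -> S s /\ s < c.
  move=> Ts; have : (T1 `|` T2) s by right.
  by rewrite T12 /below /= in_itv.
have T12_0 : T1 `&` T2 = set0.
  apply/seteqP; split => s //= -[s1 s2].
  by have := sep _ _ s1 s2; rewrite subrr normr0; lra.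
have N12_0 : N1 `&` N2 = set0.
  apply/seteqP; split => s //= -[[u u1 su] [w w2 sw]].
  have := sep _ _ u1 w2; have := ler_distD s u w; rewrite (distrC u s).
  by move: (s : R) su sw => s' su sw; lra.
have Nbelow : N1 `|` N2 = below c `&` set_nbhd g S.
  apply/seteqP; split => s /=; rewrite /below /= in_itv /=.
    have lt_c u : S u -> u < c -> `|s - u| < g -> (s : R) < c.
      move=> Su uc su; have := cut_below hc Su uc; have := ler_norm (s - u).
      by move: (s : R) su => s' su; lra.
    move=> [[u u1 su]|[u u2 su]].
      by have [Su uc] := T1S _ u1; split; [exact: lt_c su|exists u].
    by have [Su uc] := T2S _ u2; split; [exact: lt_c su|exists u].
  move=> [sc [u Su su]].
  have uc : u < c.
    rewrite ltNge; apply/negP => cu; have := cut_above hc Su cu.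
    have := ler_norm (u - s); rewrite distrC; move: (s : R) sc su => s' sc su; lra.
  have : (T1 `|` T2) u by rewrite T12 /below; split; rewrite //= in_itv.
  by move=> [u1|u2]; [left|right]; exists u.
have EAs x : EA T1 x + EA T2 x = EA (below c) x.
  by rewrite -(pvmU hEA x mT1 mT2 T12_0) T12 setIC (EA_spectrum hip saA hA spA).
have EBs x : EB N1 x + EB N2 x = EB (below c) x.
  rewrite -(pvmU hEB x mN1 mN2 N12_0) Nbelow -(pvmI hEB)//.
  by rewrite (pvm_nbhd_spectrum hip saA saV contV hA hB spA normV).
have EAc x : EA (below c) x + EA (~` below c) x = x by rewrite (pvmC hEA)// addrC subrK.
have EBc x : EB (below c) x + EB (~` below c) x = x by rewrite (pvmC hEB)// addrC subrK.
have ch := half_line_compact hip saA saV hA hB spA g0 cV hc.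
have c1 : compact_map (fun x => EA T1 x - EB N1 x).
  apply: eq_compact_map (compact_mapB ch c2) => x.
  have -> : EA T1 x = EA (below c) x - EA T2 x by rewrite -EAs addrK.
  have -> : EB N1 x = EB (below c) x - EB N2 x by rewrite -EBs addrK.
  by rewrite !opprB addrACA [RHS]addrACA [- _ - _]addrC.
have c3 : compact_map (fun x => EA (~` below c) x - EB (~` below c) x).
  apply: eq_compact_map (compact_mapN ch) => x.
  by rewrite !(pvmC hEA, pvmC hEB)// opprB [RHS]addrC opprB addrA subrK.
split => //.
have ob (T : set borel) : T `<=` below c -> T `&` (~` below c) = set0.
  by move=> h; apply/seteqP; split => s //= -[/h].
have T1b : T1 `<=` below c by move=> s /T1S[_]; rewrite /below /= in_itv.
have T2b : T2 `<=` below c by move=> s /T2S[_]; rewrite /below /= in_itv.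
have Nb s : (N1 `|` N2) s -> below c s by rewrite Nbelow => -[].
have N1b : N1 `<=` below c by move=> s Ns; apply: Nb; left.
have N2b : N2 `<=` below c by move=> s Ns; apply: Nb; right.
pose DA := blocks T1 T2 (~` below c); pose DB := blocks N1 N2 (~` below c).
have mDA j : measurable (DA j) by apply: blocks_all.
have mDB j : measurable (DB j) by apply: blocks_all.
have DA0 := blocks_disjoint T12_0 (ob _ T1b) (ob _ T2b).
have DB0 := blocks_disjoint N12_0 (ob _ N1b) (ob _ N2b).
apply: (@index_zero_complement _ _ _ hip 3 (EA \o DA) (EB \o DB) ord0).
- by move=> j; exact: pvm_proj.
- by move=> j; exact: pvm_proj.
- by move=> x; rewrite !big_ord_recl big_ord0 /= addr0 addrA EAs EAc.
- by move=> x; rewrite !big_ord_recl big_ord0 /= addr0 addrA EBs EBc.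
- by move=> i j x /DA0 ij; exact: (pvm_disjoint hEA).
- by move=> i j x /DB0 ij; exact: (pvm_disjoint hEB).
- by move=> [[|[|[|//]]] hj].
- move=> [[|[|[|//]]] hj] //= _.
  exact: (half_line_indexC hip saA hA hB spA hV).
Qed.

(** If the last point of [T1] before [c] precedes that of [T2], the gap following
  it contains a cut, at distance at least [2 * g] below [c]. *)
Lemma lower_cut c (T1 T2 : set R) : cut S g c -> T1 `|` T2 = S ->
  separated T1 T2 -> T1 `&` below c !=set0 -> T2 `&` below c !=set0 ->
  sup (T1 `&` below c) <= sup (T2 `&` below c) ->
  exists c', [/\ cut S g c', c' <= c - (g + g) &
    T1 `&` below c' = T1 `&` below c].
Proof.
move=> hc TS sep ne1 ne2; have gp := g0.
have ub (T : set R) : T `<=` S -> forall u, (T `&` below c) u -> u <= c - g.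
  move=> hT u [Tu]; rewrite /below /= in_itv /= => uc.
  by apply: (cut_below hc) => //; exact: hT.
have T1S : T1 `<=` S by rewrite -TS; exact: subsetUl.
have T2S : T2 `<=` S by rewrite -TS; exact: subsetUr.
set U1 : set R := T1 `&` below c; set U2 : set R := T2 `&` below c.
have hs1 : has_sup U1 by split => //; exists (c - g) => u /(ub _ T1S).
have hs2 : has_sup U2 by split => //; exists (c - g) => u /(ub _ T2S).
set s := sup U1; set t := sup U2 => st.
have le_s u : U1 u -> u <= s by exact: sup_upper_bound hs1 u.
have le_t u : U2 u -> u <= t by exact: sup_upper_bound hs2 u.
have tc : t <= c - g by apply: ge_sup => // u /(ub _ T2S).
have near_s e : 0 < e -> exists2 u, T1 u & s - e < u <= s.
  move=> e0; have [u hu su] := sup_adherent e0 hs1.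
  by exists u; [case: hu|rewrite su le_s].
have far u : T2 u -> s < u -> s + (g + g) <= u.
  move=> T2u su; rewrite leNgt; apply/negP => h.
  have [|w T1w /andP[w1 w2]] := near_s (s + (g + g) - u); first by lra.
  by have := sep _ _ T1w T2u; rewrite ltr0_norm; lra.
have std : s + (g + g) <= t.
  have [st'|ts] := ltP s t.
    have [|u [T2u uc] su] := sup_adherent _ hs2 (eps := t - s); first by rewrite subr_gt0.
    apply: (@le_trans _ _ u); last by apply: le_t; split.
    by apply: far => //; move: su; rewrite -/t; lra.
  have [u [T2u uc] tu] := sup_adherent g0 hs2; rewrite -/t in tu.
  have ut : u <= t by apply: le_t; split.
  have [w T1w /andP[w1 w2]] := near_s _ g0.
  have : `|w - u| < g by rewrite ltr_norml; apply/andP; split; lra.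
  by have := sep _ _ T1w T2u; lra.
have sgc : s + g <= c by lra.
exists (s + g); split; last first.
- apply/seteqP; split => u [T1u]; rewrite /below /= !in_itv /= => uc; split => //.
    by exact: lt_le_trans uc sgc.
  have us : u <= s by apply: le_s; split; rewrite // /below /= in_itv.
  by apply: le_lt_trans us _; rewrite ltrDl.
- by lra.
- move=> u; rewrite -TS => -[T1u|T2u].
    have [uc|cu] := ltP u c.
      have us : u <= s by apply: le_s; split; rewrite // /below /= in_itv.
      by rewrite ltr0_norm; lra.
    have := cut_above hc (T1S _ T1u) cu => cu'.
    by rewrite ger0_norm; lra.
  have [us|/(far _ T2u) su] := leP u s; first by rewrite ltr0_norm; lra.
  by rewrite ger0_norm; lra.
Qed.

(** Induction on the height of the cut. If both clusters have points below [c],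
  let [T1] be the one that ends first: a cut [2 * g] lower leaves [T1] below it
  unchanged, and [balanced_complement] handles [T2]. *)
Lemma balanced_below (lo : R) : (forall s, S s -> lo <= s) ->
  forall n c (T1 T2 : set borel), cut S g c -> c < lo + (g + g) *+ n ->
  measurable T1 -> measurable T2 -> T1 `|` T2 = S -> separated T1 T2 ->
  balanced (T1 `&` below c).
Proof.
move=> hlo; elim=> [|n IH] c T1 T2 hc cn mT1 mT2 TS sep.
  rewrite (_ : _ `&` _ = set0); first exact: balanced0.
  apply/seteqP; split => u //= -[T1u]; rewrite /below /= in_itv /= => uc.
  have : lo <= u by apply: hlo; rewrite -TS; left.
  by move: (u : R) uc => v vc; move: cn; rewrite mulr0n; lra.
have mb := @measurable_below R c.
have TS' : T2 `|` T1 = S by rewrite setUC.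
have cn' c' : c' <= c - (g + g) -> c' < lo + (g + g) *+ n.
  by move: cn; rewrite mulrS; lra.
have compl : balanced (T2 `&` below c) -> balanced (T1 `&` below c).
  apply: (balanced_complement hc).
  - exact: measurableI.
  - exact: measurableI.
  - by move=> u w [T1u _] [T2w _]; exact: sep.
  - by rewrite -setIUl TS.
have [->|/set0P ne1] := eqVneq (T1 `&` below c) set0; first exact: balanced0.
have [T20|/set0P ne2] := eqVneq (T2 `&` below c) set0.
  by apply: compl; rewrite T20; exact: balanced0.
have [st|/ltW ts] := leP (sup (T1 `&` below c : set R)) (sup (T2 `&` below c : set R)).
  have [c' [hc' cc' <-]] := lower_cut hc TS sep ne1 ne2 st.
  exact: IH hc' (cn' _ cc') mT1 mT2 TS sep.
have [c' [hc' cc' E]] := lower_cut hc TS' (separatedC sep) ne2 ne1 ts.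
apply: compl; rewrite -E.
exact: IH hc' (cn' _ cc') mT2 mT1 TS' (separatedC sep).
Qed.

Lemma balanced_cluster (T1 T2 : set borel) : continuous A ->
  measurable T1 -> measurable T2 -> T1 `|` T2 = S -> separated T1 T2 ->
  balanced T1.
Proof.
move=> contA mT1 mT2 TS sep; have gp := g0.
have [M M0 hM] := spectrum_bounded contA spA.
have ST1 : T1 `&` below (M + g) = T1.
  apply/setIidPl => u T1u; rewrite /below /= in_itv /=.
  have := hM u; rewrite -TS => /(_ (or_introl T1u)); have := ler_norm (u : R).
  by move: (u : R) => v; lra.
have hc : cut S g (M + g).
  move=> u /hM; have := ler_norm u => h1 h2; rewrite ltr0_norm; lra.
have lo u : S u -> - M <= u by move=> /hM; rewrite ler_norml => /andP[].
have [n hn] : exists n, M + g < - M + (g + g) *+ n.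
  exists (Num.trunc ((M + g + M) / (g + g))).+1.
  have := truncnS_gt ((M + g + M) / (g + g)).
  by rewrite ltr_pdivrMr ?addr_gt0// mulr_natl; lra.
by rewrite -ST1; exact: (balanced_below lo hc hn mT1 mT2 TS sep).
Qed.

End clusters.

(** * The perturbation theorem *)

Lemma set_dist_le (R : realType) (S T : set R) s t :
  S s -> T t -> set_dist S T <= `|s - t|.
Proof.
move=> Ss Tt; apply: ge_inf; last by exists s => //; exists t.
by exists 0 => _ [u _ [w _ <-]].
Qed.

Lemma closed_cluster (R : realType) (S1 S2 : set R) (d : R) : 0 < d ->
  closed (S1 `|` S2) -> (forall s t, S1 s -> S2 t -> d <= `|s - t|) -> closed S1.
Proof.
move=> d0 cS sep t clt.
have [//|S2t] : (S1 `|` S2) t by apply: cS; exact: closure_subset clt.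
have [s [S1s /=]] := clt _ (nbhsx_ballx t d d0).
by rewrite /ball /= distrC ltNge sep.
Qed.

Theorem theorem2 (R : realType) (H : completeNormedModType R[i])
    (ip : {dot H for Num.conj}) (hip : induces_norm ip) (hsep : separable H)
    (A V : {linear H -> H})
    (cA : continuous A) (cV : continuous V)
    (saA : self_adjoint ip A) (saV : self_adjoint ip V)
    (sigma Sigma : set R) (d : R)
    (sigma0 : sigma !=set0) (Sigma0 : Sigma !=set0)
    (specA : spectrum A = [set (t%:C)%C | t in sigma `|` Sigma])
    (hd : set_dist sigma Sigma = d) (d0 : 0 < d)
    (EA EAV : set (measurableTypeR R) -> {linear H -> H})
    (hEA : spectral_measure ip A EA)
    (hEAV : spectral_measure ip (A \+ V) EAV)
    (P Q : {linear H -> H})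
    (hP : P = EA sigma) (hQ : Q = EAV (set_nbhd (d / 2) sigma))
    (Vcompact : compact_operator V) (Vd : op_norm V < d / 2) :
  [/\ fredholm_pair P Q, pair_index P Q = 0,
      finite_dimensional (op_ker (fun x => P (op_perp Q x) - x)),
      finite_dimensional (op_ker (fun x => op_perp P (Q x) - x))
    & dimension (op_ker (fun x => P (op_perp Q x) - x)) =
      dimension (op_ker (fun x => op_perp P (Q x) - x))].
Proof.
have sep s t : sigma s -> Sigma t -> d <= `|s - t|.
  by move=> ss St; rewrite -hd; exact: set_dist_le.
have cS := spectrum_closed specA.
have c1 : closed sigma by exact: closed_cluster d0 cS sep.
have c2 : closed Sigma.
  apply: closed_cluster d0 (_ : closed (Sigma `|` sigma)) _; first by rewrite setUC.
  by move=> s t Ss st; rewrite distrC; exact: sep.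
have m1 : measurable (sigma : set (measurableTypeR R)) by exact: closed_borel.
have m2 : measurable (Sigma : set (measurableTypeR R)) by exact: closed_borel.
have mN : measurable (set_nbhd (d / 2) sigma : set (measurableTypeR R)).
  by apply: open_borel; exact: open_set_nbhd.
have g0 : 0 < d / 2 by rewrite divr_gt0.
have sep' : separated (d / 2) sigma Sigma by move=> s t ss St; rewrite -splitr; exact: sep.
have [cPQ iPQ] := balanced_cluster hip saA saV hEA hEAV specA g0 cV Vd
  (compact_operator_map Vcompact) cA m1 m2 erefl sep'.
rewrite hP hQ; apply: (index_zero_fredholm hip) => //.
- exact: (pvm_proj (proj1 hEA) m1).
- exact: (pvm_proj (proj1 hEAV) mN).
Qed.
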